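(* Let $U$ be a random variable uniformly distributed on $[0,1]$. For a random variable $P$: (i) $P$ is a p-variable if and only if $P\ge_1 \mathbb{E}[U\mid V]$ for some random variable $V$ which is a strictly increasing function of $U$; (ii) $P$ is a mid p-variable if and only if $P\ge_1 \mathbb{E}[U\mid V]$ for some random variable $V$ which is an increasing function of $U$; (iii) $P$ is a p*-variable if and only if $P\ge_1 \mathbb{E}[U\mid V]$ for some random variable $V$ (with no restriction on $V$).
   Context: All random variables live on a fixed atomless probability space $(\Omega,\mathcal A,\mathbb P)$, assumed rich enough that for any given random vector there exists a random variable uniform on $[0,1]$ independent of it. ''Increasing'' is in the non-strict sense unless ''strictly'' is written. For random variables $X,Y$: $X\le_1 Y$ (equivalently $Y\ge_1 X$) means $\mathbb E[f(X)]\le \mathbb E[f(Y)]$ for all increasing real functions $f$ such that the expectations exist; $X\le_2 Y$ means the same inequality for all increasing concave real functions $f$ such that the expectations exist. With $U_0$ denoting a uniform random variable on $[0,1]$: $P$ is a p-variable if $U_0\le_1 P$ (equivalently $\mathbb P(P\le\alpha)\le\alpha$ for all $\alpha\in(0,1)$); $P$ is a p*-variable if $U_0\le_2 P$. $P$ is a mid p-variable if $P\ge_1 P_T$ for some real random variable $T$, where $P_T=\tfrac12 F(T-)+\tfrac12 F(T)$, $F$ is the distribution function of $T$, and $F(t-)=\lim_{s\uparrow t}F(s)$. Conditional expectations are understood almost surely. *)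

(* Defs.v *)
From HB Require Import structures.
From mathcomp Require Import all_boot all_order all_algebra.
From mathcomp Require Import all_classical all_reals all_analysis.
Import numFieldNormedType.Exports.
Import Order.TTheory GRing.Theory Num.Theory.

Set Implicit Arguments.
Unset Strict Implicit.
Unset Printing Implicit Defensive.

Local Open Scope classical_set_scope.
Local Open Scope ring_scope.

Definition increasing (R : realType) (f : R -> R) : Prop :=
  {homo f : x y / x <= y}.

Definition strictly_increasing (R : realType) (f : R -> R) : Prop :=
  {homo f : x y / x < y}.

Definition concave (R : realType) (f : R -> R) : Prop :=
  @convex_function R R^o setT (fun x => - f x).

Definition atomless d (T : measurableType d) (R : realType)
    (Pr : probability T R) : Prop :=
  forall A : set T, measurable A -> (0 < Pr A)%E ->
    exists B : set T, [/\ measurable B, B `<=` A & (0 < Pr B < Pr A)%E].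

Definition uniform01 d (T : measurableType d) (R : realType)
    (Pr : probability T R) (U : {RV Pr >-> R}) : Prop :=
  forall A : set R, measurable A ->
    distribution Pr U A = uniform_prob (@ltr01 R) A.

Definition independent d d1 d2 (T : measurableType d) (T1 : measurableType d1)
    (T2 : measurableType d2) (R : realType) (Pr : probability T R)
    (X : {RV Pr >-> T1}) (Y : {RV Pr >-> T2}) : Prop :=
  forall (A : set T1) (B : set T2), measurable A -> measurable B ->
    Pr (X @^-1` A `&` Y @^-1` B) = (Pr (X @^-1` A) * Pr (Y @^-1` B))%E.

Definition rich d (T : measurableType d) (R : realType)
    (Pr : probability T R) : Prop :=
  forall (n : nat) (X : {RV Pr >-> n.-tuple R}),
    exists W : {RV Pr >-> R}, uniform01 W /\ independent X W.

(* E[X] exists in [-oo, +oo]: the positive and the negative part of X do not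
   both have an infinite expectation.  Requiring integrability instead would
   make every X with E[X^-] = +oo vacuously larger than anything for [le_icv]. *)
Definition expectation_exists d (T : measurableType d) (R : realType)
    (Pr : probability T R) (X : T -> R) : Prop :=
  ('E_Pr[(X ^\+)%R] < +oo)%E \/ ('E_Pr[(X ^\-)%R] < +oo)%E.

(* The usual stochastic order. *)
Definition le_st d (T : measurableType d) (R : realType)
    (Pr : probability T R) (X Y : T -> R) : Prop :=
  forall f : R -> R, increasing f ->
    expectation_exists Pr (f \o X) -> expectation_exists Pr (f \o Y) ->
    ('E_Pr[f \o X] <= 'E_Pr[f \o Y])%E.

(* The increasing concave order. *)
Definition le_icv d (T : measurableType d) (R : realType)
    (Pr : probability T R) (X Y : T -> R) : Prop :=
  forall f : R -> R, increasing f -> concave f ->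
    expectation_exists Pr (f \o X) -> expectation_exists Pr (f \o Y) ->
    ('E_Pr[f \o X] <= 'E_Pr[f \o Y])%E.

Definition p_variable d (T : measurableType d) (R : realType)
    (Pr : probability T R) (P : {RV Pr >-> R}) : Prop :=
  exists U0 : {RV Pr >-> R}, uniform01 U0 /\ le_st Pr U0 P.

Definition pstar_variable d (T : measurableType d) (R : realType)
    (Pr : probability T R) (P : {RV Pr >-> R}) : Prop :=
  exists U0 : {RV Pr >-> R}, uniform01 U0 /\ le_icv Pr U0 P.

Definition mid_transform d (T : measurableType d) (R : realType)
    (Pr : probability T R) (X : {RV Pr >-> R}) (w : T) : R :=
  let F (t : R) : R := fine (cdf X t) in
  2^-1 * lim (F s @[s --> (X w)^'-]) + 2^-1 * F (X w).

Definition mid_p_variable d (T : measurableType d) (R : realType)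
    (Pr : probability T R) (P : {RV Pr >-> R}) : Prop :=
  exists X : {RV Pr >-> R}, le_st Pr (mid_transform X) P.

(* Y is a version of E[X | V]. *)
Definition is_cond_expectation d (T : measurableType d) (R : realType)
    (Pr : probability T R) (Y X V : {RV Pr >-> R}) : Prop :=
  [/\ g_sigma_algebra_preimage Y `<=` g_sigma_algebra_preimage V,
      Pr.-integrable setT (EFin \o Y) &
      forall A, g_sigma_algebra_preimage V A ->
        (\int[Pr]_(w in A) (Y w)%:E = \int[Pr]_(w in A) (X w)%:E)%E].

(* E[X | V] is determined up to almost sure equality, to which [le_st] is
   insensitive. *)
Definition ge_st_cond_expectation d (T : measurableType d) (R : realType)
    (Pr : probability T R) (P X V : {RV Pr >-> R}) : Prop :=
  exists Y : {RV Pr >-> R}, is_cond_expectation Y X V /\ le_st Pr Y P.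

(* Main.v *)
(* (i), (ii): for increasing g and V = g(U), the mid distribution function of V
   at V is a version of E[U | V]: on {V <= c} both integrate to P(V <= c)^2 / 2.
   Hence mid p-variables dominate exactly the E[U | g(U)], a given law being that
   of g(U) for a quantile function g; for strictly increasing g one gets U itself.

   (iii), from right to left: conditional Jensen.  From left to right: let q be
   the quantile function of P truncated to [0, 1].  The order of U and P says that
   Psi1(t) = int_0^t (q - u)^+ du dominates Psi2(t) = int_0^t (u - q)^+ du.  As in
   the inverse transform martingale coupling of Jourdain and Margheriti, a point u
   with q(u) > u is paired with the point v where Psi2(v) = Psi1(u), so that
   u < q(u) <= q(v) < v.  Given U = u, move to v with probability
   (q(u) - u) / (v - u), and symmetrically from v to u; points u whose partner
   does not exist are left alone.  This kernel is reversible, so the label L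
   reached from U is again uniform, and E[U | L] is q(L), or L <= q(L) at the
   points without a partner; it is thus dominated by q(L), distributed as the
   truncation of P. *)
Require Import Defs.
From HB Require Import structures.
From mathcomp Require Import all_boot all_order all_algebra.
From mathcomp Require Import all_classical all_reals all_analysis.
From mathcomp Require Import measurable_realfun.
From mathcomp Require Import ring lra.
Import numFieldNormedType.Exports.
Import Order.TTheory GRing.Theory Num.Theory.

Set Implicit Arguments.
Unset Strict Implicit.
Unset Printing Implicit Defensive.

Local Open Scope classical_set_scope.
Local Open Scope ring_scope.

(** * Weighted laws on the real line *)

(** The kernel is reversible because mass is conserved: Psi2(v) = Psi1(u) gives (q(u) - u) du = (v -
    q(v)) dv, and both moves divide by the same v - u. This also yields E[U | L]: looking back from
    L one sees the kernel that leads forward from U, and the probabilities are chosen so that its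
    mean displacement at u is q(u) - u. The order is tested on the functions min(x, c), which are
    increasing and concave. It bounds the mean of q from below only, so Psi1(1) may exceed Psi2(1);
    the excess of upward mass is what stays without a partner. Psi1 and Psi2 need not be injective,
    so the partner maps are mutually inverse only up to sets that the weights do not charge. Pairs
    (u, v) are therefore handled through their common law, as quantiles of the two weighted measures
    at the same level of mass. Identities between measures, among them the defining property of a
    conditional expectation, are checked on rays V <= t. This reduces them to identities between
    real expectations of bounded variables. *)

Section weighted_law.
Local Open Scope ereal_scope.
Context {R : realType}.

(** Measurability and nonnegativity of the weight are arguments, so that the measure structure
    declared below can be inferred from the term itself. *)
Definition density d (T : measurableType d) (mu : {measure set T -> \bar R})
    (w : T -> \bar R) (mw : measurable_fun [set: T] w) (w0 : forall x, 0 <= w x) :=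
  fun A : set T => \int[mu]_(x in A) w x.

Section density_measure.
Context d (T : measurableType d) (mu : {measure set T -> \bar R}).
Variables (w : T -> \bar R) (mw : measurable_fun setT w) (w0 : forall x, 0 <= w x).

Let density0 : density mu mw w0 set0 = 0.
Proof. exact: integral_set0. Qed.

Let density_ge0 A : 0 <= density mu mw w0 A.
Proof. exact: integral_ge0. Qed.

Let density_sigma_additive : semi_sigma_additive (density mu mw w0).
Proof.
move=> F mF tF mUF; rewrite /density ge0_integral_bigcup//.
- apply: is_cvg_ereal_nneg_natsum_cond => n _ _; exact: integral_ge0.
- exact: measurable_funTS.
Qed.

HB.instance Definition _ := isMeasure.Build _ _ _ (density mu mw w0)
  density0 density_ge0 density_sigma_additive.

Import HBNNSimple.

(** Both sides are linear and pass to increasing limits of simple functions, so the identity reduces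
    to indicators, where it is the definition of [density]. *)
Lemma ge0_integral_density (f : T -> \bar R) :
    measurable_fun setT f -> (forall x, 0 <= f x) ->
  \int[density mu mw w0]_x f x = \int[mu]_x (w x * f x).
Proof.
move=> mf f0; pose h := nnsfun_approx measurableT mf.
have nd_h x : {homo (fun n => (h n x)%:E) : n m / (n <= m)%N >-> n <= m}.
  by move=> n m nm; rewrite lee_fin; exact/lefP/nd_nnsfun_approx.
have cvg_h x : (EFin \o h n) x @[n --> \oo] --> f x.
  by apply: cvg_nnsfun_approx => //.
have mh n : measurable_fun setT (EFin \o h n) by exact/measurable_EFinP.
have -> : \int[density mu mw w0]_x f x =
    limn (fun n => \int[density mu mw w0]_x (EFin \o h n) x).
  rewrite -monotone_convergence//.
  - by apply: eq_integral => x _; exact/esym/cvg_lim.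
  - by move=> n x _ /=; rewrite lee_fin.
  - by move=> x _; exact: nd_h.
have -> : \int[mu]_x (w x * f x) =
    limn (fun n => \int[mu]_x (w x * (EFin \o h n) x)).
  rewrite -monotone_convergence//.
  - apply: eq_integral => x _; apply/esym/cvg_lim => //.
    (* Products in the extended reals are not continuous at 0 * oo, so zeros of [w] and of [f] are
       set apart; at a zero of [f] the approximants, lying below [f], vanish too. *)
    have [->|wx] := eqVneq (w x) 0.
      by rewrite mul0e; under eq_fun do rewrite mul0e; exact: cvg_cst.
    have [fx|fx] := eqVneq (f x) 0.
      have h0 n : (h n x)%:E = 0.
        apply/eqP; rewrite eq_le; apply/andP; split; last by rewrite lee_fin.
        rewrite -fx -(cvg_unique _ (ereal_nondecreasing_cvgn (nd_h x)) (cvg_h x))//.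
        by apply: ereal_sup_ubound; exists n.
      by rewrite fx mule0; under eq_fun do rewrite /= h0 mule0; exact: cvg_cst.
    have wf : w x *? f x by rewrite mule_defE (negbTE wx) (negbTE fx).
    exact: (cvgeM wf (cvg_cst (w x)) (cvg_h x)).
  - by move=> n; exact: emeasurable_funM.
  - by move=> n x _; rewrite mule_ge0//= lee_fin.
  - by move=> x _ n m nm; rewrite lee_wpmul2l//; exact: nd_h.
suff suf n : \int[density mu mw w0]_x (EFin \o h n) x =
    \int[mu]_x (w x * (EFin \o h n) x) by under eq_fun do rewrite suf.
have mind r : measurable_fun setT (fun x => (r * \1_(h n @^-1` [set r]) x)%:E).
  exact/measurable_EFinP/measurable_funM.
transitivity (\sum_(r \in range (h n))
    \int[density mu mw w0]_x (r * \1_(h n @^-1` [set r]) x)%:E).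
  rewrite -ge0_integral_fsum//; last by move=> r x _; exact: nnfun_muleindic_ge0.
  by apply: eq_integral => x _; rewrite /= fimfunE -fsumEFin.
transitivity (\sum_(r \in range (h n))
    \int[mu]_x (w x * (r * \1_(h n @^-1` [set r]) x)%:E)); last first.
  rewrite -ge0_integral_fsum//.
  - apply: eq_integral => x _ /=.
    rewrite -ge0_mule_fsumr; last by move=> r; exact: nnfun_muleindic_ge0.
    by rewrite [in RHS]fimfunE -fsumEFin.
  - by move=> r; exact: emeasurable_funM.
  - by move=> r x _; rewrite mule_ge0//; exact: nnfun_muleindic_ge0.
apply: eq_fsbigr => r; rewrite inE => -[t _ rE].
have r0 : (0 <= r)%R by rewrite -rE.
pose A := h n @^-1` [set r].
have mAs : measurable A by rewrite /A -(setTI (_ @^-1` _)); exact: (measurable_funP (h n)).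
have mA : measurable_fun setT (fun x : T => (\1_A x)%:E : \bar R).
  by apply/measurable_EFinP; exact: measurable_indic.
transitivity (r%:E * \int[density mu mw w0]_x (\1_A x)%:E).
  by rewrite -ge0_integralZl//; apply: eq_integral => x _; rewrite EFinM.
transitivity (r%:E * \int[mu]_x (w x * (\1_A x)%:E)); last first.
  rewrite -ge0_integralZl//.
  - by apply: eq_integral => x _; rewrite EFinM muleCA.
  - exact: emeasurable_funM.
  - by move=> x _; rewrite mule_ge0.
rewrite integral_indic// setIT /= {1}/density.
congr (_ * _); rewrite integral_mkcond; apply: eq_integral => x _.
by rewrite epatch_indic.
Qed.

End density_measure.

Lemma measurable_set_itvNyc :
  (measurable : set (set R)) = <<s [set A | exists x : R, A = `]-oo, x]%classic] >>.
Proof.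
apply/seteqP; split => A.
- rewrite [X in X A -> _](RGenOInfty.measurableE R).
  apply: smallest_sub; first exact: smallest_sigma_algebra.
  move=> _ [x ->]; rewrite -setCitvl.
  have [_ + _] := smallest_sigma_algebra setT [set A | exists x : R, A = `]-oo, x]%classic].
  rewrite /= -setTD; apply.
  by apply: sub_sigma_algebra; exists x.
- apply: smallest_sub; first exact: sigma_algebra_measurable.
  by move=> _ [x ->]; exact: measurable_itv.
Qed.

(** Closed left rays form a pi-system generating the Borel sets, and those with natural endpoints
    exhaust the line with finite measure. *)
Lemma measure_eq_rays (m1 m2 : {measure set R -> \bar R}) :
    (forall t : R, m1 `]-oo, t]%classic = m2 `]-oo, t]%classic) ->
    (forall t : R, m1 `]-oo, t]%classic < +oo) ->
  forall A, measurable A -> m1 A = m2 A.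
Proof.
move=> m12 m1oo A mA.
pose G := [set A | exists x : R, A = `]-oo, x]%classic].
apply: (@measure_unique _ R _ G
  (fun n : nat => `]-oo, n%:R]%classic) _ _ _ _ m1 m2 _ _ A mA) => //.
- exact: measurable_set_itvNyc.
- move=> _ _ [x ->] [y ->]; exists (Order.min x y).
  by apply/seteqP; split => z /=; rewrite !in_itv/= le_min; [case=> -> ->|case/andP].
- by move=> n; exists n%:R.
- apply/seteqP; split => // x _; exists (Num.truncn x).+1 => //=.
  by rewrite in_itv/= ltW// truncnS_gt.
- by move=> _ [x ->].
Qed.

(** Both sides integrate [h] against the law of [a1], resp. [a2], weighted by [w1], resp. [w2];
    these finite measures agree on rays. Equality in law, quantile sampling and conditional
    expectations all rest on this passage from rays to Borel functions. *)
Lemma ge0_integral_eq_rays d1 d2 (T1 : measurableType d1) (T2 : measurableType d2)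
    (mu1 : {measure set T1 -> \bar R}) (mu2 : {measure set T2 -> \bar R})
    (w1 : T1 -> \bar R) (w2 : T2 -> \bar R) (a1 : T1 -> R) (a2 : T2 -> R) :
    measurable_fun setT w1 -> measurable_fun setT w2 ->
    measurable_fun setT a1 -> measurable_fun setT a2 ->
    (forall x, 0 <= w1 x) -> (forall x, 0 <= w2 x) ->
    \int[mu1]_x w1 x < +oo ->
    (forall t : R, \int[mu1]_(x in [set x | (a1 x <= t)%R]) w1 x =
      \int[mu2]_(x in [set x | (a2 x <= t)%R]) w2 x) ->
  forall h : R -> \bar R, measurable_fun setT h -> (forall y, 0 <= h y) ->
    \int[mu1]_x (w1 x * h (a1 x)) = \int[mu2]_x (w2 x * h (a2 x)).
Proof.
move=> mw1 mw2 ma1 ma2 w10 w20 foo e h mh h0.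
rewrite -(ge0_integral_density mu1 mw1 w10 (measurableT_comp mh ma1))//.
rewrite -(ge0_integral_density mu2 mw2 w20 (measurableT_comp mh ma2))//.
pose A1 : {mfun T1 >-> R} := mfun_Sub (mem_set ma1).
pose A2 : {mfun T2 >-> R} := mfun_Sub (mem_set ma2).
have p1 := @ge0_integral_pushforward _ _ _ _ _ a1 ma1 (density mu1 mw1 w10) setT h
  measurableT mh (fun y _ => h0 y).
have p2 := @ge0_integral_pushforward _ _ _ _ _ a2 ma2 (density mu2 mw2 w20) setT h
  measurableT mh (fun y _ => h0 y).
rewrite !preimage_setT in p1 p2; rewrite -p1 -p2.
apply: (eq_measure_integral (pushforward (density mu2 mw2 w20) A2)) => A mA _.
have rayE (T : Type) (a : T -> R) t : a @^-1` `]-oo, t]%classic = [set x | (a x <= t)%R].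
  by apply/seteqP; split=> x /=; rewrite in_itv.
apply: (measure_eq_rays (m1 := pushforward (density mu1 mw1 w10) A1)
  (m2 := pushforward (density mu2 mw2 w20) A2)) mA => t.
- by have := e t; rewrite -(rayE _ a1) -(rayE _ a2); exact.
- apply: le_lt_trans foo; apply: ge0_subset_integral => //.
  by rewrite -(setTI (_ @^-1` _)); exact: (measurable_funP A1).
- by move=> x; exact: h0.
- by move=> x; exact: h0.
Qed.

End weighted_law.
(** * Bounded random variables, equality in law, stochastic order *)

Section bounded_expectation.
Context d (T : measurableType d) (R : realType) (Pr : probability T R).
Implicit Types (f g : T -> R) (b : T -> bool).

(** The bound holds everywhere and makes expectations finite, so that most computations take place
    in [R]; extended values remain only for test functions that may be unbounded. *)
Definition bounded_measurable f :=
  measurable_fun setT f /\ exists M : R, forall x, `|f x| <= M.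

Local Notation bddm := bounded_measurable.
Local Notation E f := (\int[Pr]_w f w).

Lemma bddm_measurable f : bddm f -> measurable_fun setT f.
Proof. by case. Qed.

Lemma bddm_itv (lo hi : R) f : measurable_fun setT f ->
  (forall x, lo <= f x <= hi) -> bddm f.
Proof.
move=> mf fb; split=> //; exists (`|lo| + `|hi|) => x.
have /andP[lof fhi] := fb x; rewrite ler_norml.
have := ler_norm (- lo); have := ler_norm hi; have := normr_ge0 hi; have := normr_ge0 lo.
by rewrite normrN => *; apply/andP; split; lra.
Qed.

Lemma bddm_cst (c : R) : bddm (fun=> c).
Proof. by split; [exact: measurable_cst|exists `|c|]. Qed.

Lemma bddmD f g : bddm f -> bddm g -> bddm (fun x => f x + g x).
Proof.
move=> [mf [M fM]] [mg [N gN]]; split; first exact: measurable_funD.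
by exists (M + N) => x; rewrite (le_trans (ler_normD _ _))// lerD.
Qed.

Lemma bddmB f g : bddm f -> bddm g -> bddm (fun x => f x - g x).
Proof.
move=> [mf [M fM]] [mg [N gN]]; split; first exact: measurable_funB.
by exists (M + N) => x; rewrite (le_trans (ler_normB _ _))// lerD.
Qed.

Lemma bddmM f g : bddm f -> bddm g -> bddm (fun x => f x * g x).
Proof.
move=> [mf [M fM]] [mg [N gN]]; split; first exact: measurable_funM.
by exists (M * N) => x; rewrite normrM ler_pM.
Qed.

Lemma bddm_bool b : measurable_fun setT b -> bddm (fun x => (b x)%:R).
Proof.
move=> mb; apply: (@bddm_itv 0 1); last by move=> x; case: (b x); rewrite ?lexx ?ler01.
rewrite (_ : (fun _ => _) = fun x => if b x then 1 else 0).
  by apply: measurable_fun_ifT => //; exact: measurable_cst.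
by apply/funext => x; case: (b x).
Qed.

Lemma bddm_max f g : bddm f -> bddm g -> bddm (fun x => Order.max (f x) (g x)).
Proof.
move=> [mf [M fM]] [mg [N gN]]; split; first exact: measurable_maxr.
exists (M + N) => x; have := fM x; have := gN x; rewrite maxEle.
have := normr_ge0 (f x); have := normr_ge0 (g x).
by case: ifP => _ *; lra.
Qed.

Lemma bddm_integrable f : bddm f -> Pr.-integrable setT (EFin \o f).
Proof.
move=> [mf [M fM]]; apply: measurable_bounded_integrable => //.
  exact: le_lt_trans (probability_le1 Pr measurableT) (ltry 1).
exists M; split; first exact: num_real.
by move=> x Mx y _ /=; rewrite (le_trans (fM y))// ltW.
Qed.

Lemma EFin_expectation f : bddm f -> (E f)%:E = (\int[Pr]_w (f w)%:E)%E.
Proof.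
by move=> bf; rewrite /Rintegral fineK//; apply: integrable_fin_num => //; exact: bddm_integrable.
Qed.

Lemma expectation_add f g : bddm f -> bddm g -> E (fun w => f w + g w) = E f + E g.
Proof. by move=> bf bg; rewrite RintegralD//; exact: bddm_integrable. Qed.

Lemma expectation_sub f g : bddm f -> bddm g -> E (fun w => f w - g w) = E f - E g.
Proof. by move=> bf bg; rewrite RintegralB//; exact: bddm_integrable. Qed.

Lemma expectation_scale (c : R) f : bddm f -> E (fun w => c * f w) = c * E f.
Proof. by move=> bf; rewrite RintegralZl//; exact: bddm_integrable. Qed.

Lemma expectation_const (c : R) : E (fun=> c) = c.
Proof. by rewrite Rintegral_cst//= (congr1 fine (probability_setT Pr)) mulr1. Qed.

Lemma expectation_ae_le f g : bddm f -> bddm g ->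
  {ae Pr, forall w, f w <= g w} -> E f <= E g.
Proof.
move=> bf bg fg; have [mf _] := bf; have [mg _] := bg.
have h0 : bddm (fun w => Order.max (g w - f w) 0).
  by apply: bddm_max; [exact: bddmB|exact: bddm_cst].
rewrite -subr_ge0 -expectation_sub//.
(* The difference is nonnegative only almost surely; its positive part is so everywhere and has the
   same expectation. *)
suff -> : E (fun w => g w - f w) = E (fun w => Order.max (g w - f w) 0).
  by apply: Rintegral_ge0 => w _; rewrite le_max lexx orbT.
apply: EFin_inj; rewrite !EFin_expectation//; last exact: bddmB.
apply: ae_eq_integral => //.
- by apply/measurable_EFinP; exact: measurable_funB.
- by apply/measurable_EFinP; case: h0.
- by apply: filterS fg => w fg _; rewrite max_l// subr_ge0.
Qed.

Lemma expectation_ae_eq f g : bddm f -> bddm g ->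
  {ae Pr, forall w, f w = g w} -> E f = E g.
Proof.
by move=> bf bg fg; apply/le_anti/andP; split; apply: expectation_ae_le => //;
  apply: filterS fg => w ->.
Qed.

Lemma expectation_le_bddm f g : bddm f -> bddm g ->
  (forall w, f w <= g w) -> E f <= E g.
Proof. by move=> bf bg fg; apply: expectation_ae_le => //; exact: aeW. Qed.

Lemma expectation_bool_ge0 b : 0 <= E (fun w => (b w)%:R).
Proof. by apply: Rintegral_ge0 => w _. Qed.

Lemma measurable_bool b : measurable_fun setT b -> measurable [set w | b w].
Proof. by move=> mb; rewrite -[X in measurable X]setTI; exact: mb. Qed.

Lemma prob_expectation b : measurable_fun setT b ->
  Pr [set w | b w] = (E (fun w => (b w)%:R))%:E.
Proof.
move=> mb; have mB := measurable_bool mb.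
rewrite EFin_expectation; last exact: bddm_bool.
have := @integral_indic _ _ _ Pr setT measurableT _ mB; rewrite setIT => <-.
apply: eq_integral => w _; rewrite indicE (_ : (w \in _) = b w)//.
by apply/idP/idP; rewrite inE.
Qed.

Lemma prob_bool_eq0 b : measurable_fun setT b ->
  E (fun w => (b w)%:R) = 0 -> {ae Pr, forall w, ~~ b w}.
Proof.
move=> mb b0; exists [set w | b w]; split; first exact: measurable_bool.
  by rewrite prob_expectation// b0.
by move=> w /= /negP; rewrite negbK.
Qed.

Lemma expectation_eq0_ae f : bddm f -> (forall w, 0 <= f w) -> E f = 0 ->
  {ae Pr, forall w, f w = 0}.
Proof.
move=> bf f0 Ef; have [mf _] := bf.
have : (\int[Pr]_w `|(f w)%:E| = 0)%E.
  rewrite -[RHS](congr1 EFin Ef) EFin_expectation//.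
  by apply: eq_integral => w _; rewrite gee0_abs// lee_fin.
have mfe : measurable_fun setT (EFin \o f) by exact/measurable_EFinP.
by move=> /(ae_eq_integral_abs Pr measurableT mfe); apply: filterS => w /(_ I) [].
Qed.

End bounded_expectation.
Notation bddm := bounded_measurable.

Lemma measurable_le_cst d (T : measurableType d) (R : realType) (Z : T -> R) (t : R) :
  measurable_fun setT Z -> measurable_fun setT (fun w => Z w <= t).
Proof. by move=> mZ; apply: measurable_fun_ler => //; exact: measurable_cst. Qed.

Lemma measurable_lt_cst d (T : measurableType d) (R : realType) (Z : T -> R) (t : R) :
  measurable_fun setT Z -> measurable_fun setT (fun w => Z w < t).
Proof. by move=> mZ; apply: measurable_fun_ltr => //; exact: measurable_cst. Qed.

(** * Equality in law and its effect on the stochastic order *)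

Section equality_in_law.
Context d (T : measurableType d) (R : realType) (Pr : probability T R).
Implicit Types (X Y : T -> R).

(** Nonnegative extended-valued test functions need no integrability; signed ones are reached
    through their positive and negative parts. *)
Definition eq_law X Y := forall h : R -> \bar R, measurable_fun setT h ->
  (forall y, 0 <= h y)%E -> (\int[Pr]_w h (X w) = \int[Pr]_w h (Y w))%E.

Lemma eq_law_expectation X Y (h : R -> R) : eq_law X Y -> measurable_fun setT h ->
  (forall y, 0 <= h y) -> \int[Pr]_w h (X w) = \int[Pr]_w h (Y w).
Proof.
move=> XY mh h0; rewrite /Rintegral; congr fine; apply: (XY (EFin \o h)).
  exact/measurable_EFinP.
by move=> y; rewrite /= lee_fin.
Qed.

Lemma eq_law_sym X Y : eq_law X Y -> eq_law Y X.
Proof. by move=> XY h mh h0; rewrite XY. Qed.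

Lemma eq_law_comp (m : R -> R) X Y : measurable_fun setT m -> eq_law X Y ->
  eq_law (m \o X) (m \o Y).
Proof.
by move=> mm XY h mh h0; apply: (XY (h \o m)) => [|y]; [exact: measurableT_comp|exact: h0].
Qed.

Lemma eq_law_ae X Y : measurable_fun setT X -> measurable_fun setT Y ->
  {ae Pr, forall w, X w = Y w} -> eq_law X Y.
Proof.
move=> mX mY XY h mh h0; apply: ge0_ae_eq_integral => //.
- exact: measurableT_comp mh mX.
- exact: measurableT_comp mh mY.
- by apply: filterS XY => w ->.
Qed.

Lemma eq_law_cdf X Y : measurable_fun setT X -> measurable_fun setT Y ->
    (forall t : R, \int[Pr]_w (X w <= t)%R%:R = \int[Pr]_w (Y w <= t)%R%:R) ->
  eq_law X Y.
Proof.
move=> mX mY XY h mh h0.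
have lec Z t := @measurable_le_cst _ T R Z t.
have := @ge0_integral_eq_rays R _ _ T T Pr Pr (fun=> 1%E) (fun=> 1%E) X Y
  (measurable_cst _) (measurable_cst _) mX mY (fun=> lee01) (fun=> lee01) _ _ h mh h0.
have mul1E (Z : T -> R) : (\int[Pr]_w (1 * h (Z w)) = \int[Pr]_w h (Z w))%E.
  by apply: eq_integral => w _; rewrite mul1e.
rewrite !mul1E; apply=> [|t].
  by rewrite integral_cst// mul1e (le_lt_trans (probability_le1 Pr measurableT))// ltry.
have mXt := measurable_bool (lec _ t mX); have mYt := measurable_bool (lec _ t mY).
rewrite !integral_cst// !mul1e.
apply: etrans (prob_expectation Pr (lec _ t mX)) _.
by rewrite XY; exact/esym/prob_expectation/lec.
Qed.

Lemma increasing_measurable (f : R -> R) : increasing f -> measurable_fun setT f.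
Proof. by move=> f_nd; apply: nondecreasing_measurable. Qed.

Lemma eq_law_E X Y (f : R -> R) : measurable_fun setT X -> measurable_fun setT Y ->
  measurable_fun setT f -> eq_law X Y -> ('E_Pr[f \o X] = 'E_Pr[f \o Y])%E.
Proof.
move=> mX mY mf XY; rewrite unlock [LHS]integralE [RHS]integralE.
have mfe : measurable_fun setT (EFin \o f) by exact/measurable_EFinP.
congr (_ - _)%E.
- rewrite (eq_integral (fun w => (EFin \o f)^\+%E (X w))); last first.
    by move=> w _; rewrite !funeposE.
  rewrite XY => [|//|y]; [|exact: measurable_funepos|exact: funepos_ge0].
  by apply: eq_integral => w _; rewrite !funeposE.
- rewrite (eq_integral (fun w => (EFin \o f)^\-%E (X w))); last first.
    by move=> w _; rewrite !funenegE.
  rewrite XY => [|//|y]; [|exact: measurable_funeneg|exact: funeneg_ge0].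
  by apply: eq_integral => w _; rewrite !funenegE.
Qed.

Lemma eq_law_expectation_exists X Y (f : R -> R) :
    measurable_fun setT X -> measurable_fun setT Y ->
    measurable_fun setT f -> eq_law X Y ->
  expectation_exists Pr (f \o X) -> expectation_exists Pr (f \o Y).
Proof.
move=> mX mY mf XY; rewrite /expectation_exists.
have -> : (f \o X)^\+%R = f^\+%R \o X by [].
have -> : (f \o X)^\-%R = f^\-%R \o X by [].
by rewrite (eq_law_E mX mY (measurable_funrpos mf) XY)
  (eq_law_E mX mY (measurable_funrneg mf) XY).
Qed.

Lemma eq_law_le_st X X' P : measurable_fun setT X -> measurable_fun setT X' ->
  eq_law X X' -> le_st Pr X P -> le_st Pr X' P.
Proof.
move=> mX mX' XX' XP f f_nd eX' eP; have mf := increasing_measurable f_nd.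
rewrite -(eq_law_E mX mX' mf XX'); apply: XP => //.
exact: eq_law_expectation_exists (eq_law_sym XX') eX'.
Qed.

(** Positive parts are ordered one way and negative parts the other, and the difference of their
    integrals is monotone even when infinite. *)
Lemma ae_le_integral (D : set T) (f g : T -> \bar R) : measurable D ->
    measurable_fun D f -> measurable_fun D g ->
    {ae Pr, forall w, D w -> (f w <= g w)%E} ->
  (\int[Pr]_(w in D) f w <= \int[Pr]_(w in D) g w)%E.
Proof.
move=> mD mf mg fg; rewrite [leLHS]integralE [leRHS]integralE.
apply: leeB; apply: ae_ge0_le_integral => //;
  try exact: measurable_funepos; try exact: measurable_funeneg.
- apply: filterS fg => w fg Dw; rewrite !funeposE.
  by rewrite ge_max !le_max fg//= lexx orbT.
- apply: filterS fg => w fg Dw; rewrite !funenegE.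
  by rewrite ge_max !le_max leeN2 fg//= lexx orbT.
Qed.

Lemma expectation_ae_monotone (f g : T -> R) :
    measurable_fun setT f -> measurable_fun setT g ->
  {ae Pr, forall w, f w <= g w} -> ('E_Pr[f] <= 'E_Pr[g])%E.
Proof.
move=> mf mg fg; rewrite unlock; apply: ae_le_integral => //; try exact/measurable_EFinP.
by apply: filterS fg => w fg _; rewrite lee_fin.
Qed.

Lemma bddm_expectation_exists (f : T -> R) : bddm f -> expectation_exists Pr f.
Proof.
move=> [mf [M fM]]; left; rewrite unlock.
have bf : bddm (f^\+)%R.
  apply: (@bddm_itv _ _ _ 0 M); first exact: measurable_funrpos.
  move=> w; rewrite /funrpos le_max lexx orbT ge_max.
  by rewrite (le_trans (ler_norm _) (fM w)) (le_trans (normr_ge0 _) (fM w)).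
by rewrite -EFin_expectation// ltry.
Qed.

End equality_in_law.
(** * Uniform and mid distribution functions *)

Section uniform_law.
Context d (T : measurableType d) (R : realType) (Pr : probability T R).
Variable U : {RV Pr >-> R}.
Hypothesis U_unif : uniform01 U.

Lemma uniform01_lebesgue (A : set R) : measurable A ->
  Pr (U @^-1` A) = lebesgue_measure (A `&` `[0, 1]).
Proof.
move=> mA; have := U_unif mA; rewrite /distribution /pushforward => ->.
rewrite /uniform_prob integral_uniform_pdf.
rewrite (eq_integral (cst 1%E)); last first.
  move=> x /[!inE] -[_ /=]; rewrite in_itv/= => x01.
  by rewrite /uniform_pdf x01 subr0 invr1.
by rewrite integral_cst ?mul1e//; apply: measurableI.
Qed.

Lemma uniform01_ae : {ae Pr, forall w, 0 <= U w <= 1}.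
Proof.
exists (U @^-1` (~` `[0, 1])); split.
- by rewrite -[X in measurable X]setTI; apply: (measurable_funP U) => //; exact: measurableC.
- rewrite uniform01_lebesgue; last exact: measurableC.
  by rewrite setICl measure0.
- by move=> w /=; rewrite in_itv/=.
Qed.

Lemma uniform01_le (t : R) : 0 <= t <= 1 -> \int[Pr]_w (U w <= t)%R%:R = t.
Proof.
move=> /andP[t0 t1]; apply: EFin_inj; rewrite -prob_expectation; last first.
  exact/measurable_le_cst/measurable_funP.
have := @uniform01_lebesgue `]-oo, t]%classic (measurable_itv _).
rewrite (_ : `]-oo, t] `&` `[0, 1] = `[0, t])%classic; last first.
  apply/seteqP; split => x /=; rewrite !in_itv/=.
    by move=> [xt /andP[-> _]].
  by move=> /andP[-> xt]; rewrite xt (le_trans xt).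
rewrite lebesgue_measure_itv/= lte_fin => UE.
have {UE} -> : Pr [set w | U w <= t] = (if 0 < t then (t%:E - 0%:E)%E else 0%E).
  by rewrite -UE; congr (Pr _); apply/seteqP; split=> x /=; rewrite in_itv.
by rewrite -EFinB subr0; case: ltgtP t0 => // <-.
Qed.

Lemma uniform01_lt (t : R) : 0 <= t <= 1 -> \int[Pr]_w (U w < t)%R%:R = t.
Proof.
move=> /andP[t0 t1]; apply: EFin_inj; rewrite -prob_expectation; last first.
  exact/measurable_lt_cst/measurable_funP.
have := @uniform01_lebesgue `]-oo, t[%classic (measurable_itv _).
rewrite (_ : `]-oo, t[ `&` `[0, 1] = `[0, t[)%classic; last first.
  apply/seteqP; split => x /=; rewrite !in_itv/=.
    by move=> [xt /andP[-> _]].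
  by move=> /andP[-> xt]; rewrite xt (le_trans (ltW xt)).
rewrite lebesgue_measure_itv/= lte_fin => UE.
have {UE} -> : Pr [set w | U w < t] = (if 0 < t then (t%:E - 0%:E)%E else 0%E).
  by rewrite -UE; congr (Pr _); apply/seteqP; split=> x /=; rewrite in_itv.
by rewrite -EFinB subr0; case: ltgtP t0 => // <-.
Qed.

End uniform_law.

(** * Mid distribution functions *)

Section mid_distribution.
Context d (T : measurableType d) (R : realType) (Pr : probability T R).
Implicit Types X : T -> R.

(** The left limit F(t-) enters as P(X < t), which makes monotonicity and the exchange of two
    independent copies direct; [mid_transformE] ties this form to [mid_transform]. *)
Definition mid X (t : R) : R :=
  (\int[Pr]_w (X w < t)%R%:R + \int[Pr]_w (X w <= t)%R%:R) / 2.

Lemma probability_bool (b : T -> bool) : measurable_fun setT b ->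
  0 <= \int[Pr]_w (b w)%:R <= 1.
Proof.
move=> mb; rewrite expectation_bool_ge0/= -{2}(expectation_const Pr 1).
apply: expectation_le_bddm; [exact: bddm_bool|exact: bddm_cst|].
by move=> w; case: (b w).
Qed.

Lemma mid_itv X t : measurable_fun setT X -> 0 <= mid X t <= 1.
Proof.
move=> mX; have /andP[a0 a1] := probability_bool (measurable_lt_cst t mX).
have /andP[b0 b1] := probability_bool (measurable_le_cst t mX).
by rewrite /mid; apply/andP; split; lra.
Qed.

Lemma mid_increasing X : measurable_fun setT X -> increasing (mid X).
Proof.
move=> mX s t st; rewrite /mid ler_pM2r ?invr_gt0// lerD//; apply: expectation_le_bddm;
  try by apply/bddm_bool/measurable_lt_cst.
- by move=> w; rewrite ler_nat; case: ltP => // /lt_le_trans/(_ st) ->.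
- by apply/bddm_bool/measurable_le_cst.
- by apply/bddm_bool/measurable_le_cst.
- by move=> w; rewrite ler_nat; case: leP => // /le_trans/(_ st) ->.
Qed.

Lemma cdfE (X : {RV Pr >-> R}) t : fine (cdf X t) = \int[Pr]_w (X w <= t)%R%:R.
Proof.
rewrite /cdf /distribution /pushforward.
have -> : X @^-1` `]-oo, t]%classic = [set w | X w <= t].
  by apply/seteqP; split=> x /=; rewrite in_itv.
by rewrite (prob_expectation Pr (measurable_le_cst t (measurable_funP X))).
Qed.

(** Along a sequence tending to [t] from strictly below, each indicator is eventually constant,
    equal to that of [X w < t]; dominated convergence concludes. *)
Lemma cdf_left_limit X t : measurable_fun setT X ->
  (\int[Pr]_w (X w <= s)%R%:R) @[s --> t^'-] --> \int[Pr]_w (X w < t)%R%:R.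
Proof.
move=> mX; apply/cvg_at_leftP => u [ut cu].
have bl s := @bddm_bool _ T R _ (measurable_le_cst s mX).
have bt := @bddm_bool _ T R _ (measurable_lt_cst t mX).
apply: (@cvg_trans _ (fine (\int[Pr]_w ((X w <= u n)%R%:R)%:E) @[n --> \oo])) => //.
apply: fine_cvg; rewrite EFin_expectation//.
apply: (@dominated_cvg _ _ _ Pr setT measurableT
  (fun n w => ((X w <= u n)%R%:R)%:E) _ (cst 1%E)) => //.
- by move=> n; apply/measurable_EFinP; exact: bddm_measurable.
- move=> w _; apply: cvg_near_cst.
  case: (ltP (X w) t) => Xt.
  + have : \forall n \near \oo, X w < u n by apply: (cvgr_gt _ cu).
    by apply: filterS => n /ltW ->.
  + by apply: nearW => n; rewrite leNgt (lt_le_trans (ut n) Xt).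
- exact: (bddm_integrable _ (bddm_cst T 1)).
- by move=> n w _; rewrite /= lee_fin; case: (X w <= u n); rewrite ?normr1 ?normr0.
Qed.

Lemma mid_transformE (X : {RV Pr >-> R}) w : mid_transform X w = mid X (X w).
Proof.
rewrite /mid_transform /mid.
have -> : (fun s : R => fine (cdf X s)) = fun s => \int[Pr]_w (X w <= s)%R%:R.
  by apply/funext => s; exact: cdfE.
rewrite cdfE (cvg_lim _ (@cdf_left_limit X (X w) (measurable_funP X)))//.
by rewrite mulrDl mulrC; congr (_ + _); rewrite mulrC.
Qed.

(* Swapping the roles of two independent copies X, X' of X in P(X' < X <= c)
   gives P(X < X' <= c), so both halves of the mid distribution function add up
   to P(X <= c)^2. *)
Lemma expectation_mid_le X c : measurable_fun setT X ->
  \int[Pr]_w (mid X (X w) * (X w <= c)%R%:R) = (\int[Pr]_w (X w <= c)%R%:R) ^+ 2 / 2.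
Proof.
move=> mX; set F := \int[Pr]_w (X w <= c)%R%:R.
have bl s := @bddm_bool _ T R _ (measurable_le_cst s mX).
have bt s := @bddm_bool _ T R _ (measurable_lt_cst s mX).
pose H s := \int[Pr]_w (X w < s)%R%:R.
pose G s := \int[Pr]_w (X w <= s)%R%:R.
have Hnd : increasing H.
  move=> s t st; apply: expectation_le_bddm => // w; rewrite ler_nat.
  by case: ltP => // /lt_le_trans/(_ st) ->.
have Gnd : increasing G.
  move=> s t st; apply: expectation_le_bddm => // w; rewrite ler_nat.
  by case: leP => // /le_trans/(_ st) ->.
have bH : bddm (fun w => H (X w)).
  apply: (@bddm_itv _ _ _ 0 1) => [|w]; last exact/probability_bool/measurable_lt_cst.
  exact: measurableT_comp (increasing_measurable Hnd) mX.
have bG : bddm (fun w => G (X w)).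
  apply: (@bddm_itv _ _ _ 0 1) => [|w]; last exact/probability_bool/measurable_le_cst.
  exact: measurableT_comp (increasing_measurable Gnd) mX.
have bHc : bddm (fun w => H (X w) * (X w <= c)%R%:R) by exact: bddmM.
have bGc : bddm (fun w => G (X w) * (X w <= c)%R%:R) by exact: bddmM.
have -> : \int[Pr]_w (mid X (X w) * (X w <= c)%R%:R) =
    2^-1 * (\int[Pr]_w (H (X w) * (X w <= c)%R%:R) + \int[Pr]_w (G (X w) * (X w <= c)%R%:R)).
  rewrite -expectation_add// -expectation_scale; last exact: bddmD.
  by apply: eq_Rintegral => w _; rewrite /mid -/(H _) -/(G _); ring.
suff -> : \int[Pr]_w (H (X w) * (X w <= c)%R%:R) =
    \int[Pr]_w ((F - G (X w)) * (X w <= c)%R%:R).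
  have -> : \int[Pr]_w ((F - G (X w)) * (X w <= c)%R%:R) =
      \int[Pr]_w (F * (X w <= c)%R%:R - G (X w) * (X w <= c)%R%:R).
    by apply: eq_Rintegral => w _; rewrite mulrBl.
  rewrite expectation_sub//; last by apply: bddmM => //; exact: bddm_cst.
  by rewrite expectation_scale// -/F; field.
pose f (z : T * T) : R := ((X z.2 < X z.1) && (X z.1 <= c))%R%:R.
have mf : measurable_fun setT (EFin \o f).
  apply/measurable_EFinP; apply: bddm_measurable; apply: bddm_bool.
  apply: measurable_and.
    by apply: measurable_fun_ltr; exact: measurableT_comp.
  by apply: measurable_le_cst; exact: measurableT_comp.
have f0 z : (0 <= (EFin \o f) z)%E by rewrite lee_fin.
have Fub := @fubini_tonelli _ _ _ _ _ Pr Pr _ mf f0.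
apply: EFin_inj; rewrite !EFin_expectation//; last first.
  by apply: bddmM => //; apply: bddmB => //; exact: bddm_cst.
transitivity (\int[Pr]_x \int[Pr]_y (EFin \o f) (x, y))%E.
  apply: eq_integral => x _; rewrite -EFin_expectation; last first.
    by apply: bddm_bool; apply: measurable_and; [exact: (measurable_lt_cst (X x) mX)|exact: (measurable_cst (X x <= c))].
  congr EFin; rewrite mulrC /H -expectation_scale//.
  by apply: eq_Rintegral => w _; rewrite /f/= mulr_natl -mulrnA mulnb andbC.
rewrite Fub; apply: eq_integral => y _ /=; rewrite -EFin_expectation; last first.
  apply: bddm_bool; apply: measurable_and; last exact: (measurable_le_cst c mX).
  exact: (measurable_fun_ltr (measurable_cst (X y)) mX).
congr EFin; rewrite mulrC /F /G -expectation_sub// -expectation_scale; last exact: bddmB.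
apply: eq_Rintegral => w _; rewrite /f/=.
case: (ltP (X y) (X w)) => yw /=; case: (leP (X w) c) => wc; case: (leP (X y) c) => yc;
  rewrite ?(subr0, subrr, mulr0, mulr1, mul0r, mul1r)//;
  by exfalso; clear -yw wc yc; lra.
Qed.

End mid_distribution.
(** * Conditional expectations *)

Section conditional_expectation.
Context d (T : measurableType d) (R : realType) (Pr : probability T R).

Lemma exists_RV (f : T -> R) : measurable_fun setT f ->
  exists X : {RV Pr >-> R}, X = f :> (T -> R).
Proof. by move=> mf; exists (mfun_Sub (mem_set mf)). Qed.

Lemma integral_bool (f : T -> R) (b : T -> bool) : (forall w, 0 <= f w) ->
  (\int[Pr]_(w in [set w | b w]) (f w)%:E = \int[Pr]_w (f w * (b w)%:R)%:E)%E.
Proof.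
move=> f0; rewrite integral_mkcond; apply: eq_integral => w _; rewrite /patch.
case: ifPn; first by rewrite inE/= => ->; rewrite mulr1.
by rewrite notin_setE/= => /negP/negbTE ->; rewrite mulr0.
Qed.

Lemma expectation_eq_rays (f1 f2 a1 a2 : T -> R) : bddm f1 -> bddm f2 ->
    measurable_fun setT a1 -> measurable_fun setT a2 ->
    (forall w, 0 <= f1 w) -> (forall w, 0 <= f2 w) ->
    (forall t : R, \int[Pr]_w (f1 w * (a1 w <= t)%R%:R) = \int[Pr]_w (f2 w * (a2 w <= t)%R%:R)) ->
  forall h : R -> \bar R, measurable_fun setT h -> (forall y, 0 <= h y)%E ->
  (\int[Pr]_w ((f1 w)%:E * h (a1 w)) = \int[Pr]_w ((f2 w)%:E * h (a2 w)))%E.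
Proof.
move=> b1 b2 ma1 ma2 f10 f20 e h mh h0.
apply: (@ge0_integral_eq_rays R _ _ T T Pr Pr (EFin \o f1) (EFin \o f2)) => //.
- by apply/measurable_EFinP; case: b1.
- by apply/measurable_EFinP; case: b2.
- by rewrite -EFin_expectation// ltry.
- move=> t; rewrite [LHS]integral_bool// [RHS]integral_bool//.
  rewrite -!EFin_expectation ?e//; apply: bddmM => //; apply: bddm_bool; exact: measurable_le_cst.
Qed.

(** The rays determine the laws of [V] weighted by [Y] and by [U'], hence the integrals over every
    event of the sigma-algebra of [V]. [U'] is a version of [U] that is bounded and nonnegative
    everywhere. *)
Lemma cond_expectation_rays (U V Y : {RV Pr >-> R}) (U' : T -> R) (m : R -> R) :
    bddm U' -> (forall w, 0 <= U' w) -> {ae Pr, forall w, U w = U' w} ->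
    measurable_fun setT m -> Y = m \o V :> (T -> R) ->
    bddm Y -> (forall w, 0 <= Y w) ->
    (forall t : R, \int[Pr]_w (Y w * (V w <= t)%R%:R) = \int[Pr]_w (U' w * (V w <= t)%R%:R)) ->
  is_cond_expectation Y U V.
Proof.
move=> bU' U'0 UU' mm YE bY Y0 e; split.
- move=> A [B mB <-]; exists (m @^-1` B); last by rewrite YE.
  by rewrite -[X in measurable X]setTI; exact: mm.
- exact: bddm_integrable.
move=> A [B mB]; rewrite setTI => <-.
have mVB : measurable (V @^-1` B).
  by rewrite -[X in measurable X]setTI; exact: (measurable_funP V).
transitivity (\int[Pr]_(w in V @^-1` B) (U' w)%:E)%E; last first.
  apply: ae_eq_integral => //.
  - by apply/measurable_EFinP; apply: measurable_funTS; case: bU'.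
  - by apply/measurable_EFinP; apply: measurable_funTS; exact: (measurable_funP U).
  - by apply: filterS UU' => w ->.
have indE (f : T -> R) : (\int[Pr]_(w in V @^-1` B) (f w)%:E =
    \int[Pr]_w ((f w)%:E * (\1_B (V w))%:E))%E.
  by rewrite integral_mkcond; apply: eq_integral => w _; rewrite epatch_indic.
rewrite !indE.
apply: (expectation_eq_rays bY bU' (measurable_funP V) (measurable_funP V) Y0 U'0 e
  (h := fun y => (\1_B y)%:E)).
  by apply/measurable_EFinP; exact: measurable_indic.
by move=> y; rewrite lee_fin.
Qed.

(** The event [Y2 < Y1] belongs to the sigma-algebra of [V], so over it the integral of [Y1 - Y2]
    equals that of [U1 - U2], which is at most 0. *)
Lemma cond_expectation_ae_mono (U1 U2 V Y1 Y2 : {RV Pr >-> R}) :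
  {ae Pr, forall w, U1 w <= U2 w} ->
  is_cond_expectation Y1 U1 V -> is_cond_expectation Y2 U2 V ->
  {ae Pr, forall w, Y1 w <= Y2 w}.
Proof.
move=> U12 [Y1V iY1 eY1] [Y2V iY2 eY2].
pose D := [set w | Y2 w < Y1 w].
have DV : g_sigma_algebra_preimage V D.
  (* Viewed on [T] with the sigma-algebra of [V], both versions are measurable, and so is the event
     comparing them. *)
  pose TV := g_sigma_algebra_preimageType V.
  have mY1 : measurable_fun [set: TV] (Y1 : TV -> R).
    by move=> _ B mB; apply: Y1V; exists B.
  have mY2 : measurable_fun [set: TV] (Y2 : TV -> R).
    by move=> _ B mB; apply: Y2V; exists B.
  exact: (measurable_bool (measurable_fun_ltr mY2 mY1)).
have mD : measurable D.
  apply: measurable_bool; apply: measurable_fun_ltr; exact: measurable_funP.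
have iY1D := integrableS measurableT mD (@subsetT _ _) iY1.
have iY2D := integrableS measurableT mD (@subsetT _ _) iY2.
have : (\int[Pr]_(w in D) `|(Y1 w)%:E - (Y2 w)%:E| = 0)%E.
  transitivity (\int[Pr]_(w in D) ((EFin \o Y1) w - (EFin \o Y2) w))%E.
    apply: eq_integral => w /[!inE] Dw; rewrite gee0_abs// -EFinB lee_fin subr_ge0.
    exact: ltW.
  apply/le_anti/andP; split; last first.
    apply: integral_ge0 => w Dw; rewrite /= -EFinB lee_fin subr_ge0; exact: ltW.
  rewrite integralB// sube_le0 eY1// eY2//.
  apply: ae_le_integral => //.
  - by apply/measurable_EFinP/measurable_funTS/measurable_funP.
  - by apply/measurable_EFinP/measurable_funTS/measurable_funP.
  - by apply: filterS U12 => w U12 _; rewrite lee_fin.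
move=> /ae_eq_integral_abs h.
have {h} := h mD (emeasurable_funB (measurable_int _ iY1D) (measurable_int _ iY2D)).
apply: filterS => w h; rewrite leNgt; apply/negP => Dw.
have /= [] := h Dw; move=> /eqP; rewrite subr_eq0 => /eqP Y12.
by move: Dw; rewrite Y12 ltxx.
Qed.

Lemma cond_expectation_ae_unique (U V Y Z : {RV Pr >-> R}) :
  is_cond_expectation Y U V -> is_cond_expectation Z U V ->
  {ae Pr, forall w, Y w = Z w}.
Proof.
move=> hY hZ; have UU : {ae Pr, forall w, U w <= U w} by exact: aeW.
have YZ := cond_expectation_ae_mono UU hY hZ.
have := cond_expectation_ae_mono UU hZ hY; apply: filterS2 YZ => w YZ ZY.
by apply/le_anti; rewrite YZ.
Qed.

End conditional_expectation.

(** * Increasing functions of a uniform variable *)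

Section uniform_increasing.
Context d (T : measurableType d) (R : realType) (Pr : probability T R).
Variable U : {RV Pr >-> R}.
Hypothesis U_unif : uniform01 U.

(** A uniform variable lies in [0, 1] only almost surely; clipping gives a version that does so
    everywhere. The same map truncates [P]. *)
Definition clip01 (x : R) : R := Order.max 0 (Order.min 1 x).

Lemma clip01_itv x : 0 <= clip01 x <= 1.
Proof. by rewrite /clip01 le_max lexx ge_max ler01 ge_min lexx. Qed.

Lemma clip01_id x : 0 <= x <= 1 -> clip01 x = x.
Proof. by move=> /andP[x0 x1]; rewrite /clip01 min_r// max_r. Qed.

Lemma measurable_clip01 : measurable_fun setT clip01.
Proof.
apply: measurable_maxr; first exact: measurable_cst.
by apply: measurable_minr => //; exact: measurable_cst.
Qed.

Lemma bddm_clip01 (X : T -> R) : measurable_fun setT X -> bddm (fun w => clip01 (X w)).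
Proof.
move=> mX; apply: (@bddm_itv _ _ _ 0 1) => [|w]; last exact: clip01_itv.
exact: measurableT_comp measurable_clip01 mX.
Qed.

Lemma uniform01_clip_ae : {ae Pr, forall w, U w = clip01 (U w)}.
Proof. by apply: filterS (uniform01_ae U_unif) => w /clip01_id ->. Qed.

Lemma uniform01_neq (p : R) : 0 <= p <= 1 -> {ae Pr, forall w, U w != p}.
Proof.
move=> p01; have mU : measurable_fun setT U := measurable_funP U.
have ml := measurable_le_cst p mU; have mt := measurable_lt_cst p mU.
pose b w := (U w <= p) && ~~ (U w < p).
have mb : measurable_fun setT b.
  by apply: measurable_and => //; exact: measurable_neg.
have : {ae Pr, forall w, ~~ b w}.
  apply: (prob_bool_eq0 mb); rewrite -[RHS](subrr p).
  transitivity (\int[Pr]_w (U w <= p)%R%:R - \int[Pr]_w (U w < p)%R%:R); last first.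
    by rewrite (uniform01_le U_unif)// (uniform01_lt U_unif).
  rewrite -expectation_sub; [|exact: bddm_bool|exact: bddm_bool].
  apply: eq_Rintegral => w _; rewrite /b.
  by case: (ltgtP (U w) p) => _ /=; rewrite ?subrr ?subr0.
by apply: filterS => w; rewrite /b; case: (ltgtP (U w) p).
Qed.

Lemma uniform01_midE t : 0 <= t <= 1 -> mid Pr U t = t.
Proof.
by move=> t01; rewrite /mid (uniform01_le U_unif)// (uniform01_lt U_unif)//; field.
Qed.

(* Up to a null set, the down-set {g <= c} is the interval [0, p], where p is its
   probability. *)
Lemma expectation_uniform01_le (g : R -> R) (c : R) : increasing g ->
  \int[Pr]_w (clip01 (U w) * (g (U w) <= c)%R%:R) =
  (\int[Pr]_w (g (U w) <= c)%R%:R) ^+ 2 / 2.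
Proof.
move=> g_nd; have mU : measurable_fun setT U := measurable_funP U.
have mg := measurableT_comp (increasing_measurable g_nd) mU.
have bU := bddm_clip01 mU.
have bg := bddm_bool R (measurable_le_cst c mg).
set p : R := \int[Pr]_w (g (U w) <= c)%R%:R.
have p01 : 0 <= p <= 1 by exact/probability_bool/(measurable_le_cst c mg).
have bp := bddm_bool R (measurable_le_cst p mU).
transitivity (\int[Pr]_w (mid Pr U (U w) * (U w <= p)%R%:R)); last first.
  by rewrite expectation_mid_le// (uniform01_le U_unif).
apply: expectation_ae_eq.
- exact: bddmM.
- apply: bddmM => //; apply: (@bddm_itv _ _ _ 0 1) => [|w]; last exact: mid_itv.
  exact: measurableT_comp (increasing_measurable (mid_increasing Pr mU)) mU.
apply: filterS2 (uniform01_ae U_unif) (uniform01_neq p01) => w Uw Up.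
rewrite clip01_id// uniform01_midE//; congr (_ * _%:R).
case: (ltgtP (U w) p) Up => // Up _.
- case: leP => // cg; exfalso.
  suff : p <= U w by rewrite leNgt Up.
  rewrite -[leRHS](uniform01_lt U_unif Uw); apply: expectation_le_bddm => //.
    exact/bddm_bool/measurable_lt_cst.
  move=> v; rewrite ler_nat; case: (ltP (U v) (U w)) => vw; first exact: leq_b1.
  by rewrite leNgt (lt_le_trans cg (g_nd _ _ vw)).
- case: leP => // cg; exfalso.
  suff : U w <= p by rewrite leNgt Up.
  rewrite -[leLHS](uniform01_le U_unif Uw); apply: expectation_le_bddm => //.
    exact/bddm_bool/measurable_le_cst.
  move=> v; rewrite ler_nat; case: (leP (U v) (U w)) => // vw.
  by rewrite (le_trans (g_nd _ _ vw) cg).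
Qed.

Lemma cond_expectation_mid (g : R -> R) (V Y : {RV Pr >-> R}) : increasing g ->
  V = g \o U :> (T -> R) -> Y = mid Pr V \o V :> (T -> R) ->
  is_cond_expectation Y U V.
Proof.
move=> g_nd VE YE; have mV : measurable_fun setT V := measurable_funP V.
have mm := increasing_measurable (mid_increasing Pr mV).
have Y01 w : 0 <= Y w <= 1 by rewrite YE; exact: mid_itv.
apply: (cond_expectation_rays (U' := fun w => clip01 (U w)) (m := mid Pr V)) => //.
- exact/bddm_clip01/measurable_funP.
- by move=> w; case/andP: (clip01_itv (U w)).
- exact: uniform01_clip_ae.
- by apply: bddm_itv Y01; exact: measurable_funP.
- by move=> w; case/andP: (Y01 w).
move=> t; rewrite YE [LHS]expectation_mid_le// VE.
by rewrite -expectation_uniform01_le.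
Qed.

(** A strictly increasing [g] preserves and reflects both comparisons in [mid], leaving the mid
    distribution function of [U], the identity on [0, 1]. *)
Lemma mid_strictly_increasing (g : R -> R) : strictly_increasing g ->
  {ae Pr, forall w, mid Pr (g \o U) (g (U w)) = U w}.
Proof.
move=> g_lt; have gle := le_mono g_lt; have glt := leW_mono gle.
apply: filterS (uniform01_ae U_unif) => w Uw; rewrite -[RHS]uniform01_midE// /mid /=.
congr ((_ + _) / 2); apply: eq_Rintegral => v _; first by rewrite glt.
by rewrite gle.
Qed.

Lemma uniform01_eq_law (U0 : {RV Pr >-> R}) : uniform01 U0 -> eq_law Pr U0 U.
Proof.
move=> U0_unif; apply: eq_law_cdf => [||t]; try exact: measurable_funP.
rewrite -!cdfE /cdf; congr fine.
by rewrite (U_unif (measurable_itv _)) (U0_unif _ (measurable_itv _)).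
Qed.

End uniform_increasing.
(** * Quantile functions *)

Section generalized_inverse.
Context (R : realType).
Implicit Types (G : R -> R) (lo hi : R).

(** For increasing [G] this is right continuity, in the form that the Galois connection [ginv_le]
    consumes. *)
Definition right_semicontinuous G :=
  forall x z : R, (forall y, x < y -> z <= G y) -> z <= G x.

(* Adjoining [lo] keeps the set nonempty, hence [sup] meaningful, for every [z]. *)
Definition ginv G lo hi (z : R) : R :=
  sup [set s | lo <= s <= hi /\ (s = lo \/ G s < z)].

Section ginv_lemmas.
Variables (G : R -> R) (lo hi : R).
Hypotheses (lohi : lo <= hi) (G_nd : increasing G) (G_rc : right_semicontinuous G).

Let A z := [set s | lo <= s <= hi /\ (s = lo \/ G s < z)].

Let A_lo z : A z lo.
Proof. by split; [rewrite lexx|left]. Qed.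

Let A_ne z : A z !=set0.
Proof. by exists lo; exact: A_lo. Qed.

Let A_ub z : ubound (A z) hi.
Proof. by move=> s [/andP[]]. Qed.

Let A_sup z : has_sup (A z).
Proof. by split; [exact: A_ne|exists hi; exact: A_ub]. Qed.

Lemma ginv_itv z : lo <= ginv G lo hi z <= hi.
Proof.
apply/andP; split; first exact: (ub_le_sup (A_sup z).2 (A_lo z)).
exact: (ge_sup (A_ne z) (@A_ub z)).
Qed.

Lemma ginv_increasing : increasing (ginv G lo hi).
Proof.
move=> y z yz; apply: ge_sup; first exact: A_ne.
move=> s [slohi sy]; apply: (ub_le_sup (A_sup z).2); split=> //.
by case: sy => [->|sy]; [left|right; exact: lt_le_trans sy yz].
Qed.

(** The Galois connection characterizing a quantile function. Above level [G hi] the supremum would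
    stick at [hi] and the equivalence would fail at [x = hi]. *)
Lemma ginv_le x z : lo <= x <= hi -> z <= G hi ->
  (ginv G lo hi z <= x) = (z <= G x).
Proof.
move=> /andP[lox xhi] zhi; apply/idP/idP => [gx|zx]; last first.
  apply: ge_sup; first exact: A_ne.
  move=> s [_ [->//|sz]]; rewrite leNgt; apply/negP => xs.
  by have := lt_le_trans sz (le_trans zx (G_nd (ltW xs))); rewrite ltxx.
apply: G_rc => y xy; rewrite leNgt; apply/negP => yz.
have [yhi|hiy] := leP y hi; last first.
  by have := le_lt_trans (G_nd (ltW hiy)) yz; rewrite ltNge zhi.
suff : y <= ginv G lo hi z by rewrite leNgt (le_lt_trans gx xy).
apply: (ub_le_sup (A_sup z).2); split; last by right.
by rewrite yhi andbT (le_trans lox (ltW xy)).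
Qed.

(** The Lipschitz bound excludes jumps: from a point within [e] of the supremum, where [G] is at
    most [z], [G] gains at most [e]. *)
Lemma ginvK z : G lo <= z <= G hi ->
  (forall x y, x <= y -> G y <= G x + (y - x)) ->
  G (ginv G lo hi z) = z.
Proof.
move=> /andP[zlo zhi] G_lip; apply/le_anti/andP; split; last first.
  by rewrite -ginv_le// ginv_itv.
apply/ler_addgt0Pl => e e0.
have [s [_ slt] se] := sup_adherent e0 (A_sup z).
have sz : G s <= z by case: slt => [->|/ltW].
have [sg|/ltW gs] := leP s (ginv G lo hi z).
  apply: le_trans (G_lip _ _ sg) _; rewrite -/(ginv G lo hi z) in se.
  by lra.
by apply: le_trans (G_nd gs) _; lra.
Qed.

End ginv_lemmas.
End generalized_inverse.

(** * Inverse transform sampling of weighted laws *)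

Section quantile.
Context d (T : measurableType d) (R : realType) (Pr : probability T R).
Variable U : {RV Pr >-> R}.
Hypothesis U_unif : uniform01 U.

Section weighted_cdf.
Variables (f X : T -> R).
Hypotheses (bf : bddm f) (f0 : forall w, 0 <= f w) (mX : measurable_fun setT X).

(** For [X] uniform and [f] the positive or negative part of q(X) - X these are Psi1 and Psi2; for
    [f] constant 1 it is the distribution function. *)
Definition weighted_cdf (t : R) : R := \int[Pr]_w (f w * (X w <= t)%R%:R).

Let bfX t : bddm (fun w => f w * (X w <= t)%R%:R).
Proof. by apply: bddmM => //; exact/bddm_bool/measurable_le_cst. Qed.

Lemma weighted_cdf_increasing : increasing weighted_cdf.
Proof.
move=> s t st; apply: expectation_le_bddm => // w.
apply: ler_wpM2l => //; rewrite ler_nat.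
by case: (leP (X w) s) => // Xs; rewrite (le_trans Xs st).
Qed.

Lemma weighted_cdf_ge0 t : 0 <= weighted_cdf t.
Proof. by apply: Rintegral_ge0 => w _; rewrite mulr_ge0. Qed.

Lemma weighted_cdf_right_semicontinuous : right_semicontinuous weighted_cdf.
Proof.
move=> x z zy; have [_ [M fM]] := bf.
pose u n : R := x + n.+1%:R^-1.
have cu : u n @[n --> \oo] --> x.
  rewrite -[X in _ --> X]addr0; apply: cvgD; first exact: cvg_cst.
  exact: cvg_harmonic.
have cG : weighted_cdf (u n) @[n --> \oo] --> weighted_cdf x.
  apply: (@cvg_trans _ (fine (\int[Pr]_w (f w * (X w <= u n)%R%:R)%:E) @[n --> \oo])) => //.
  apply: fine_cvg; rewrite EFin_expectation//.
  apply: (@dominated_cvg _ _ _ Pr setT measurableT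
    (fun n w => (f w * (X w <= u n)%R%:R)%:E) _ (cst M%:E)) => //.
  - by move=> n; apply/measurable_EFinP; exact: bddm_measurable.
  - move=> w _; apply: cvg_near_cst.
    case: (leP (X w) x) => Xx.
    + by apply: nearW => n; rewrite (le_trans Xx)// lerDl invr_ge0.
    + have : \forall n \near \oo, u n < X w by apply: (cvgr_lt _ cu).
      by apply: filterS => n un; rewrite leNgt un.
  - exact: (bddm_integrable _ (bddm_cst T M)).
  - move=> n w _; rewrite /= lee_fin normrM; apply: le_trans (fM w).
    by rewrite -[leRHS]mulr1 ler_wpM2l//; case: (X w <= u n); rewrite ?normr1 ?normr0.
rewrite -(cvg_lim _ cG)//; apply: limr_ge; first by apply/cvg_ex; eexists; exact: cG.
by apply: nearW => n; apply: zy; rewrite ltrDl invr_gt0.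
Qed.

Variables (lo hi : R).
Hypothesis X_itv : forall w, lo <= X w <= hi.

Lemma weighted_cdf_hi t : hi <= t -> weighted_cdf t = \int[Pr]_w f w.
Proof.
move=> hit; apply: eq_Rintegral => w _; have /andP[_ Xhi] := X_itv w.
by rewrite (le_trans Xhi hit) mulr1.
Qed.

(** Inverse transform sampling for a law of total mass M = [weighted_cdf hi]: the generalized
    inverse at M U is at most t iff M U <= G(t), an event of probability G(t) / M. *)
Lemma quantile_law (h : R -> \bar R) : measurable_fun setT h -> (forall y, 0 <= h y)%E ->
  (\int[Pr]_w ((f w)%:E * h (X w)) =
   \int[Pr]_w ((weighted_cdf hi)%:E * h (ginv weighted_cdf lo hi (weighted_cdf hi * clip01 (U w)))))%E.
Proof.
move=> mh h0; set G := weighted_cdf; set M := G hi.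
have [w0|noT] := pselect (exists w : T, True); last first.
  by rewrite !integral0_eq// => w; exfalso; apply: noT; exists w.
have lohi : lo <= hi by have [w _] := w0; have /andP[/le_trans] := X_itv w; apply.
have M0 : 0 <= M by exact: weighted_cdf_ge0.
have mg : measurable_fun setT (fun w => ginv G lo hi (M * clip01 (U w))).
  have mz : measurable_fun setT (fun w => M * clip01 (U w)).
    apply: measurable_funM; first exact: measurable_cst.
    exact: bddm_measurable (bddm_clip01 (measurable_funP U)).
  exact: measurableT_comp (increasing_measurable (ginv_increasing G lohi)) mz.
apply: (expectation_eq_rays bf (bddm_cst T M) mX mg) => // t.
have bg := bddm_bool R (measurable_le_cst t mg).
rewrite expectation_scale// -[LHS]/(G t).
(* [ginv_le] requires [t] in [lo, hi]; outside, the ray carries none or all of both masses. *)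
have [tlo|lot] := ltP t lo.
  rewrite [G t](_ : _ = 0).
    rewrite (_ : \int[Pr]_w _ = 0) ?mulr0//; rewrite -[RHS](expectation_const Pr 0).
    apply: eq_Rintegral => w _; rewrite leNgt (lt_le_trans tlo)//.
    by case/andP: (ginv_itv G lohi (M * clip01 (U w))).
  rewrite -[RHS](expectation_const Pr 0).
  apply: eq_Rintegral => w _; rewrite leNgt (lt_le_trans tlo) ?mulr0//.
  by case/andP: (X_itv w).
have [hit|thi] := leP hi t.
  rewrite [G t](weighted_cdf_hi hit) -(weighted_cdf_hi (lexx hi)) -/M.
  rewrite (_ : \int[Pr]_w _ = 1) ?mulr1//; rewrite -[RHS](expectation_const Pr 1).
  apply: eq_Rintegral => w _; rewrite (le_trans _ hit)//.
  by case/andP: (ginv_itv G lohi (M * clip01 (U w))).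
have Gnd := weighted_cdf_increasing.
have tM : G t <= M by exact/Gnd/ltW.
have E w : (ginv G lo hi (M * clip01 (U w)) <= t) = (M * clip01 (U w) <= G t).
  apply: ginv_le => //; first exact: weighted_cdf_right_semicontinuous.
    by rewrite lot ltW.
  by rewrite -[leRHS]mulr1 ler_wpM2l//; case/andP: (clip01_itv (U w)).
have [M00|Mpos] := eqVneq M 0.
  by rewrite M00 mul0r; apply/le_anti; rewrite weighted_cdf_ge0 -M00 tM.
have {}Mpos : 0 < M by rewrite lt_def Mpos.
have sP : 0 <= G t / M <= 1.
  by rewrite divr_ge0 ?weighted_cdf_ge0//= ler_pdivrMr// mul1r.
rewrite (_ : \int[Pr]_w _ = G t / M); first by rewrite mulrC divfK// gt_eqF.
rewrite -[RHS](uniform01_le U_unif sP); apply: expectation_ae_eq => //.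
  exact/bddm_bool/measurable_le_cst/measurable_funP.
by apply: filterS (uniform01_clip_ae U_unif) => w Uw; rewrite E [in RHS]Uw ler_pdivlMr// mulrC.
Qed.

End weighted_cdf.

Lemma exists_quantile (X : T -> R) (lo hi : R) : measurable_fun setT X ->
    lo <= hi -> (forall w, lo <= X w <= hi) ->
  exists g : R -> R, [/\ increasing g, forall z, lo <= g z <= hi & eq_law Pr X (g \o U)].
Proof.
move=> mX lohi X_itv; pose F := weighted_cdf (cst 1) X.
have b1 : bddm (cst 1 : T -> R) := bddm_cst T 1.
have Fhi : F hi = 1.
  by rewrite /F (weighted_cdf_hi _ X_itv (lexx hi)) expectation_const.
exists (ginv F lo hi); split; [exact: ginv_increasing|by move=> z; exact: ginv_itv|].
move=> h mh h0.
have := quantile_law b1 (fun=> ler01) mX X_itv mh h0; rewrite -/F Fhi.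
have -> : (\int[Pr]_w ((cst 1 w)%:E * h (X w)) = \int[Pr]_w h (X w))%E.
  by apply: eq_integral => w _; rewrite mul1e.
move=> ->.
have mg := increasing_measurable (ginv_increasing F lohi).
apply: ge0_ae_eq_integral => //.
- apply: emeasurable_funM; first exact: measurable_cst.
  apply: measurableT_comp mh _; apply: measurableT_comp mg _.
  apply: measurable_funM; first exact: measurable_cst.
  exact: bddm_measurable (bddm_clip01 (measurable_funP U)).
- apply: measurableT_comp mh _; exact: measurableT_comp mg (measurable_funP U).
- by move=> w _; rewrite mule_ge0// lee_fin.
- by apply: filterS (uniform01_clip_ae U_unif) => w Uw _; rewrite mul1e mul1r -Uw.
Qed.

End quantile.

(** * p-variables and mid p-variables *)

Section p_variables.
Context d (T : measurableType d) (R : realType) (Pr : probability T R).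
Variable U : {RV Pr >-> R}.
Hypothesis U_unif : uniform01 U.
Variable P : {RV Pr >-> R}.

Lemma RV_measurable (X : {RV Pr >-> R}) : measurable_fun setT X.
Proof. exact: measurable_funP. Qed.

Lemma p_variableP : p_variable P <-> le_st Pr U P.
Proof.
split=> [[U0 [U0_unif U0P]]|UP]; last by exists U.
by apply: eq_law_le_st U0P; try exact: RV_measurable; exact: uniform01_eq_law.
Qed.

Lemma exists_mid_RV (V : {RV Pr >-> R}) :
  exists Y : {RV Pr >-> R}, Y = mid Pr V \o V :> (T -> R).
Proof.
apply: exists_RV; apply: measurableT_comp (RV_measurable V).
exact: increasing_measurable (mid_increasing Pr (RV_measurable _)).
Qed.

(** From right to left, almost sure uniqueness replaces the given version of E[U | V] by the mid
    distribution function at [V], which is almost surely [U]. *)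
Lemma p_variable_cond_expectation : p_variable P <->
  exists V : {RV Pr >-> R},
    (exists g : R -> R, strictly_increasing g /\ V = g \o U :> (T -> R)) /\
    ge_st_cond_expectation P U V.
Proof.
rewrite p_variableP; split=> [UP|[V [[g [g_lt VE]] [Y [hY YP]]]]].
  exists U; split; first by exists id; split=> // x y.
  have [Y YE] := exists_mid_RV U; exists Y.
  have hY : is_cond_expectation Y U U by apply: (cond_expectation_mid U_unif (g := id)).
  split=> //; apply: eq_law_le_st UP; try exact: RV_measurable.
  apply: eq_law_ae; try exact: RV_measurable.
  by apply: filterS (uniform01_ae U_unif) => w Uw; rewrite YE/= uniform01_midE.
have [Z ZE] := exists_mid_RV V.
have g_nd : increasing g by exact: ltW_homo.
have hZ := cond_expectation_mid U_unif g_nd VE ZE.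
apply: eq_law_le_st YP; try exact: RV_measurable.
apply: eq_law_ae; try exact: RV_measurable.
have := mid_strictly_increasing U_unif g_lt.
apply: filterS2 (cond_expectation_ae_unique hY hZ) => w -> <-.
by rewrite ZE/= VE.
Qed.

Lemma eq_law_mid (X Y : T -> R) : measurable_fun setT X -> measurable_fun setT Y ->
  eq_law Pr X Y -> mid Pr X = mid Pr Y.
Proof.
move=> mX mY XY; apply/funext => t; rewrite /mid.
have mid_ (b : R -> bool) : measurable_fun setT b ->
    \int[Pr]_w (b (X w))%:R = \int[Pr]_w (b (Y w))%:R :> R.
  move=> mb; apply: (eq_law_expectation (h := fun y => (b y)%:R) XY) => //.
  exact: bddm_measurable (bddm_bool R mb).
congr ((_ + _) / 2).
- by apply: (mid_ (fun y => y < t)); apply: (@measurable_lt_cst _ R R id t); exact: measurable_id.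
- by apply: (mid_ (fun y => y <= t)); apply: (@measurable_le_cst _ R R id t); exact: measurable_id.
Qed.

Lemma mid_p_variable_cond_expectation : mid_p_variable P <->
  exists V : {RV Pr >-> R},
    (exists g : R -> R, increasing g /\ V = g \o U :> (T -> R)) /\
    ge_st_cond_expectation P U V.
Proof.
have mtE (X : {RV Pr >-> R}) : mid_transform X = mid Pr X \o X.
  by apply/funext => w; rewrite mid_transformE.
have mmid (X : {RV Pr >-> R}) : measurable_fun setT (mid Pr X).
  exact: increasing_measurable (mid_increasing Pr (RV_measurable _)).
split=> [[X XP]|[V [[g [g_nd VE]] [Y [hY YP]]]]]; last first.
  exists V; rewrite mtE; have [Z ZE] := exists_mid_RV V.
  have hZ := cond_expectation_mid U_unif g_nd VE ZE; rewrite -ZE.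
  apply: eq_law_le_st YP; try exact: RV_measurable.
  apply: eq_law_ae; try exact: RV_measurable.
  exact: cond_expectation_ae_unique hY hZ.
(* A bounded copy of X has the same mid transform, and its quantile function is
   real-valued and increasing on the whole line. *)
pose c (x : R) := contract x%:E.
have c_lt : {mono c : x y / x < y} by move=> x y; rewrite /c lt_contract lte_fin.
have c_le : {mono c : x y / x <= y} by move=> x y; rewrite /c le_contract lee_fin.
have mc : measurable_fun setT c by apply: increasing_measurable => x y; rewrite c_le.
have mcX := measurableT_comp mc (RV_measurable X).
have cX w : -1 <= (c \o X) w <= 1 by rewrite -ler_norml; exact: contract_le1.
have N11 : -1 <= 1 :> R by lra.
have [g [g_nd _ XV]] := exists_quantile U_unif mcX N11 cX.
have mgU := measurableT_comp (increasing_measurable g_nd) (RV_measurable U).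
have [V VE] := exists_RV Pr mgU.
exists V; split; first by exists g.
have [Y YE] := exists_mid_RV V; exists Y.
split; first exact: cond_expectation_mid g_nd VE YE.
have midX : mid_transform X = mid Pr (c \o X) \o (c \o X).
  apply/funext => w; rewrite mid_transformE /mid /=.
  by congr ((_ + _) / 2); apply: eq_Rintegral => v _; rewrite ?c_lt ?c_le.
apply: eq_law_le_st XP; [| |].
- rewrite mtE; exact: measurableT_comp (mmid X) (RV_measurable X).
- exact: RV_measurable.
- rewrite midX YE -VE in XV *; rewrite (eq_law_mid mcX (RV_measurable V) XV).
  exact: eq_law_comp (mmid V) XV.
Qed.

End p_variables.
(** * Conditional Jensen inequality *)

Section concave_slopes.
Context (R : realType) (f : R -> R).
Hypotheses (f_nd : increasing f) (f_cc : concave f).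

Lemma concave_slopes (x y z : R) : x < y -> y < z ->
  (f z - f y) * (y - x) <= (f y - f x) * (z - y).
Proof.
move=> xy yz; have xz := lt_trans xy yz.
have zx0 : 0 < z - x by rewrite subr_gt0.
(* The weight of [x] when [y] is written as the barycentre t x + (1 - t) z. *)
pose t := (z - y) / (z - x).
have t0 : 0 <= t by rewrite divr_ge0 ?subr_ge0 ?ltW.
have t1 : t <= 1 by rewrite ler_pdivrMr// mul1r lerD2l lerN2 ltW.
have := f_cc (Itv01 t0 t1) (mem_set (I : setT x)) (mem_set (I : setT z)).
rewrite -[X in - f X](_ : y = _); last first.
  transitivity (t * x + (1 - t) * z); first by rewrite /t; field; rewrite gt_eqF.
  exact/esym/(@convRE R x z (Itv01 t0 t1)).
rewrite convRE/= /unstable.onem.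
have -> : 1 - t = (y - x) / (z - x) by rewrite /t; field; rewrite gt_eqF.
rewrite /t => h.
have {}h := ler_wpM2r (ltW zx0) h.
have : (- f y) * (z - x) <= - ((z - y) * f x + (y - x) * f z).
  apply: le_trans h _; rewrite le_eqVlt; apply/orP; left; apply/eqP.
  by field; rewrite gt_eqF.
by lra.
Qed.

(** The right derivative: for concave [f] the forward difference quotients decrease in the step, so
    their limit at 0 is a supremum, bounded by any backward slope. *)
Definition right_slope (y : R) : R :=
  sup [set (f (y + t) - f y) / t | t in [set t | 0 < t]].

Let S y := [set (f (y + t) - f y) / t | t in [set t | 0 < t]].

Let S_mem (y u : R) : y < u -> S y ((f u - f y) / (u - y)).
Proof.
move=> yu; exists (u - y); first by rewrite /= subr_gt0.
by rewrite (addrC y) subrK.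
Qed.

Let S_ne y : S y !=set0.
Proof. by exists ((f (y + 1) - f y) / (y + 1 - y)); apply: S_mem; rewrite ltrDl. Qed.

Let S_ub (y u : R) : u < y -> ubound (S y) ((f y - f u) / (y - u)).
Proof.
move=> uy _ [t /= t0 <-]; have yt : y < y + t by rewrite ltrDl.
have yu0 : 0 < y - u by rewrite subr_gt0.
rewrite ler_pdivrMr// mulrAC ler_pdivlMr//.
by have := concave_slopes uy yt; rewrite (addrC y) addrK.
Qed.

Let S_hasub y : has_ubound (S y).
Proof. by exists ((f y - f (y - 1)) / (y - (y - 1))); apply: S_ub; rewrite gtrBl. Qed.

Lemma right_slope_ge0 y : 0 <= right_slope y.
Proof.
have y1 : y < y + 1 by rewrite ltrDl.
apply: le_trans (ub_le_sup (S_hasub y) (S_mem y1)).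
by rewrite divr_ge0// subr_ge0 ?f_nd// ltW.
Qed.

Lemma right_slope_supergradient y u : f u <= f y + right_slope y * (u - y).
Proof.
case: (ltgtP u y) => [uy|yu|->]; last by rewrite subrr mulr0 addr0.
- have := ge_sup (S_ne y) (S_ub uy); rewrite -/(right_slope y).
  by rewrite ler_pdivlMr ?subr_gt0//; lra.
- have := ub_le_sup (S_hasub y) (S_mem yu); rewrite -/(right_slope y).
  by rewrite ler_pdivrMr ?subr_gt0//; lra.
Qed.

(** The slope of the chord between the two points separates the two values. *)
Lemma right_slope_nonincreasing : {homo right_slope : x y /~ x <= y}.
Proof.
move=> z y; rewrite le_eqVlt => /predU1P[->//|yz].
exact: le_trans (ge_sup (S_ne z) (S_ub yz)) (ub_le_sup (S_hasub y) (S_mem yz)).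
Qed.

End concave_slopes.

Section conditional_jensen.
Context d (T : measurableType d) (R : realType) (Pr : probability T R).

Lemma cond_expectation_cst (V : {RV Pr >-> R}) (c : R) :
  is_cond_expectation (cst c) (cst c) V.
Proof.
split=> //; last exact: (bddm_integrable _ (bddm_cst T c)).
move=> A [B mB <-]; rewrite setTI preimage_cst; case: ifP => _.
  by exists setT => //; rewrite setTI preimage_setT.
by exists set0 => //; rewrite preimage_set0 setI0.
Qed.

Variables (U V Y P : {RV Pr >-> R}).
Hypotheses (U_unif : uniform01 U) (YE : is_cond_expectation Y U V).

(** Comparison of [U] with the constants 0 and 1, which are their own conditional expectations. *)
Lemma cond_expectation_uniform01_ae : {ae Pr, forall w, 0 <= Y w <= 1}.
Proof.
have U01 := uniform01_ae U_unif.
have Y0 : {ae Pr, forall w, (cst 0 : T -> R) w <= Y w}.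
  apply: cond_expectation_ae_mono (cond_expectation_cst V 0) YE.
  by apply: filterS U01 => w /andP[].
have Y1 : {ae Pr, forall w, Y w <= (cst 1 : T -> R) w}.
  apply: cond_expectation_ae_mono YE (cond_expectation_cst V 1).
  by apply: filterS U01 => w /andP[].
by apply: filterS2 Y0 Y1 => w /= -> ->.
Qed.

Let U' w := clip01 (U w).
Let Y' w := clip01 (Y w).

Let mU : measurable_fun setT U. Proof. exact: measurable_funP. Qed.
Let mY : measurable_fun setT Y. Proof. exact: measurable_funP. Qed.
Let bU' : bddm U'. Proof. exact: bddm_clip01. Qed.
Let bY' : bddm Y'. Proof. exact: bddm_clip01. Qed.
Let U'0 w : 0 <= U' w. Proof. by case/andP: (clip01_itv (U w)). Qed.
Let Y'0 w : 0 <= Y' w. Proof. by case/andP: (clip01_itv (Y w)). Qed.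
Let UU' : {ae Pr, forall w, U w = U' w}. Proof. exact: uniform01_clip_ae. Qed.
Let YY' : {ae Pr, forall w, Y w = Y' w}.
Proof. by apply: filterS cond_expectation_uniform01_ae => w /clip01_id /esym. Qed.

Let cond_rays t : \int[Pr]_w (U' w * (Y' w <= t)%R%:R) = \int[Pr]_w (Y' w * (Y' w <= t)%R%:R).
Proof.
have [YV iY eY] := YE; pose D := [set w | Y w <= t].
have DV : g_sigma_algebra_preimage V D.
  apply: YV; exists `]-oo, t]%classic; first exact: measurable_itv.
  by apply/seteqP; split => w /=; rewrite in_itv/=; [case|].
have mD : measurable D by apply: measurable_bool; exact: measurable_le_cst.
have DE (f : T -> R) (f' : T -> R) : measurable_fun setT f -> bddm f' ->
    (forall w, 0 <= f' w) -> {ae Pr, forall w, f w = f' w} ->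
    (\int[Pr]_w (f' w * (Y' w <= t)%R%:R))%:E = (\int[Pr]_(w in D) (f w)%:E)%E.
  move=> mf bf' f'0 ff'; have mf' := bddm_measurable bf'.
  transitivity (\int[Pr]_(w in D) (f' w)%:E)%E; last first.
    apply: ae_eq_integral => //.
    - by apply/measurable_EFinP/measurable_funTS.
    - by apply/measurable_EFinP/measurable_funTS.
    - by apply: filterS ff' => w ->.
  have bYt := bddm_bool R (measurable_le_cst t (bddm_measurable bY')).
  rewrite [RHS]integral_bool// EFin_expectation; last exact: bddmM.
  apply: ae_eq_integral => //.
  - by apply/measurable_EFinP/bddm_measurable/bddmM.
  - apply/measurable_EFinP/bddm_measurable/bddmM => //.
    exact/bddm_bool/measurable_le_cst.
  - by apply: filterS YY' => w + _; move=> ->.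
by apply: EFin_inj; rewrite (DE U)// (DE Y)// eY.
Qed.

(** With s the right slope, f(U) <= f(Y) + s(Y) (U - Y), and the last term has expectation 0: by
    [cond_rays] the laws of [Y'] weighted by [U'] and by [Y'] agree. *)
Lemma cond_jensen (f : R -> R) : increasing f -> concave f ->
  ('E_Pr[f \o U] <= 'E_Pr[f \o Y])%E.
Proof.
move=> f_nd f_cc; have mf := increasing_measurable f_nd.
have bf (X : T -> R) : measurable_fun setT X -> bddm (fun w => f (clip01 (X w))).
  move=> mX; apply: (@bddm_itv _ _ _ (f 0) (f 1)).
    exact: measurableT_comp mf (bddm_measurable (bddm_clip01 mX)).
  by move=> w; case/andP: (clip01_itv (X w)) => X0 X1; rewrite !f_nd.
rewrite (eq_law_E mU (bddm_measurable bU') mf); last first.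
  by apply: eq_law_ae => //; exact: bddm_measurable.
rewrite (eq_law_E mY (bddm_measurable bY') mf); last first.
  by apply: eq_law_ae => //; exact: bddm_measurable.
rewrite unlock -!EFin_expectation; [|exact: bf|exact: bf]; rewrite lee_fin.
pose s := right_slope f.
have s_ni : {homo s : x y /~ x <= y} by exact: right_slope_nonincreasing.
have s0 y : 0 <= s y by exact: right_slope_ge0.
have ms : measurable_fun setT s by apply: nonincreasing_measurable => // x y xy; exact: s_ni.
(* The slope is nonnegative as [f] increases, and at most [s 0] since [Y'] is nonnegative. *)
have bs : bddm (fun w => s (Y' w)).
  apply: (@bddm_itv _ _ _ 0 (s 0)).
    exact: measurableT_comp ms (bddm_measurable bY').
  by move=> w; rewrite s0 s_ni.
have sUY : \int[Pr]_w (U' w * s (Y' w)) = \int[Pr]_w (Y' w * s (Y' w)).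
  apply: EFin_inj; rewrite !EFin_expectation; [|exact: bddmM|exact: bddmM].
  have mY' := bddm_measurable bY'.
  apply: (expectation_eq_rays bU' bY' mY' mY' U'0 Y'0 cond_rays (h := EFin \o s)).
    exact/measurable_EFinP.
  by move=> y; rewrite /= lee_fin.
apply: (@le_trans _ _ (\int[Pr]_w (f (Y' w) + (U' w * s (Y' w) - Y' w * s (Y' w))))).
  apply: expectation_le_bddm.
  - exact: bf.
  - by apply: bddmD; [exact: bf|apply: bddmB; exact: bddmM].
  - move=> w; rewrite -mulrBl mulrC; exact: right_slope_supergradient.
rewrite expectation_add; [|exact: bf|by apply: bddmB; exact: bddmM].
by rewrite expectation_sub; [|exact: bddmM|exact: bddmM]; rewrite sUY subrr addr0.
Qed.

Lemma cond_expectation_pstar : le_st Pr Y P -> pstar_variable P.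
Proof.
move=> YP; exists U; split=> // f f_nd f_cc _ eP.
apply: le_trans (cond_jensen f_nd f_cc) _; apply: YP => //.
(* What remains is the existence of the expectation of f(Y): almost surely [Y] lies in [0, 1], where
   [f] is bounded. *)
have mf := increasing_measurable f_nd.
apply: (@eq_law_expectation_exists _ _ _ _ Y') => //.
- exact: bddm_measurable.
- apply: eq_law_sym; apply: eq_law_ae => //; exact: bddm_measurable.
apply: bddm_expectation_exists; apply: (@bddm_itv _ _ _ (f 0) (f 1)).
  exact: measurableT_comp mf (bddm_measurable bY').
by move=> w; case/andP: (clip01_itv (Y w)) => X0 X1; rewrite /= !f_nd.
Qed.

End conditional_jensen.
(** * The inverse transform martingale coupling *)

Section independent_threshold.
Context d (T : measurableType d) (R : realType) (Pr : probability T R).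

Lemma exists_independent_uniform01 (U : {RV Pr >-> R}) : rich Pr ->
  exists W : {RV Pr >-> R}, uniform01 W /\ independent U W.
Proof.
move=> Pr_rich; pose X w : 1.-tuple R := [tuple U w].
have mX : measurable_fun setT X.
  apply/measurable_fun_tnthP => i; rewrite (_ : _ \o _ = U); first exact: measurable_funP.
  by apply/funext => w; rewrite /= (tnth_nth 0) ord1.
have [W [W_unif XW]] := Pr_rich 1%N (mfun_Sub (mem_set mX)).
exists W; split=> // A B mA mB.
have -> : U @^-1` A = X @^-1` [set t | A (tnth t ord0)].
  by apply/seteqP; split => w; rewrite /X /= (tnth_nth 0).
apply: XW => //; rewrite -[X in measurable X]setTI.
exact: (@measurable_tnth _ R 1 ord0 measurableT A mA).
Qed.

(** By independence (U, W) has a product law, under which W < k(U) has probability k(U) given U. A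
    kernel is thus realized by comparing [W] with a threshold. *)
Lemma expectation_threshold (U W : {RV Pr >-> R}) (g k : R -> R) :
    uniform01 W -> independent U W ->
    measurable_fun setT g -> measurable_fun setT k ->
    (forall x, 0 <= g x) -> (forall x, 0 <= k x <= 1) ->
  \int[Pr]_w (g (U w) * (W w < k (U w))%R%:R) = \int[Pr]_w (g (U w) * k (U w)).
Proof.
move=> W_unif UW mg mk g0 k01; rewrite /Rintegral; congr fine.
pose phi w := (U w, W w).
have mphi : measurable_fun setT phi by apply: measurable_fun_pair; exact: measurable_funP.
pose F (z : R * R) : \bar R := (g z.1 * (z.2 < k z.1)%R%:R)%:E.
have mF : measurable_fun setT F.
  apply/measurable_EFinP; apply: measurable_funM; first exact: measurableT_comp.
  apply: bddm_measurable; apply: bddm_bool; apply: measurable_fun_ltr => //.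
  exact: measurableT_comp.
have F0 z : (0 <= F z)%E by rewrite lee_fin mulr_ge0.
pose Phi : {mfun T >-> (R * R)%type} := mfun_Sub (mem_set mphi).
have := @ge0_integral_pushforward _ _ _ _ _ phi mphi Pr setT F measurableT mF (fun z _ => F0 z).
rewrite preimage_setT => <-.
have <- : (\int[distribution Pr U \x distribution Pr W]_z F z = \int[pushforward Pr phi]_z F z)%E.
  apply: eq_measure_integral => A mA _.
  have prodE B C : measurable B -> measurable C ->
      pushforward Pr Phi (B `*` C) = (distribution Pr U B * distribution Pr W C)%E.
    exact: UW.
  exact: (product_measure_unique (m' := pushforward Pr Phi) prodE mA).
rewrite fubini_tonelli1//.
have -> : fubini_F (distribution Pr W) F = EFin \o (fun x => g x * k x).
  apply/funext => x; rewrite /fubini_F ge0_integral_distribution//; last first.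
    exact: measurable_fun_pair2 mF.
  rewrite -[LHS]/(\int[Pr]_w (g x * (W w < k x)%R%:R)%:E)%E.
  have bW := bddm_bool R (measurable_lt_cst (k x) (measurable_funP W)).
  rewrite -EFin_expectation; last by apply: bddmM => //; exact: bddm_cst.
  by rewrite expectation_scale// (uniform01_lt W_unif).
rewrite ge0_integral_distribution//.
- by apply/measurable_EFinP; exact: measurable_funM.
- by move=> x; rewrite /= lee_fin mulr_ge0//; case/andP: (k01 x).
Qed.

End independent_threshold.

(** * Weighted distribution functions of a uniform variable *)

Section uniform_lipschitz.
Context d (T : measurableType d) (R : realType) (Pr : probability T R).
Variable U : {RV Pr >-> R}.
Hypotheses (U_unif : uniform01 U) (U01 : forall w, 0 <= U w <= 1).

Lemma uniform01_cdf (t : R) : \int[Pr]_w (U w <= t)%R%:R = clip01 t.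
Proof.
have [t0|t0] := ltP t 0.
  rewrite /clip01 min_r ?max_l//; [|lra|lra].
  rewrite -[RHS](expectation_const Pr 0); apply: eq_Rintegral => w _.
  by rewrite leNgt (lt_le_trans t0)//; case/andP: (U01 w).
have [t1|t1] := leP t 1.
  by rewrite (uniform01_le U_unif) ?clip01_id ?t0.
rewrite /clip01 min_l ?max_r//; [|lra].
rewrite -[RHS](expectation_const Pr 1); apply: eq_Rintegral => w _.
by rewrite (le_trans _ (ltW t1))//; case/andP: (U01 w).
Qed.

Lemma clip01_lipschitz (x y : R) : x <= y -> clip01 y <= clip01 x + (y - x).
Proof.
move=> xy; have /andP[cx0 _] := clip01_itv x.
rewrite {1}/clip01 ge_max; apply/andP; split; first by lra.
have m1 : Order.min 1 y <= 1 by rewrite ge_min lexx.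
have my : Order.min 1 y <= y by rewrite ge_min lexx orbT.
have : Order.min 1 y - (y - x) <= Order.min 1 x by rewrite le_min; apply/andP; split; lra.
have : Order.min 1 x <= clip01 x by rewrite /clip01 le_max lexx orbT.
by lra.
Qed.

Variable f : T -> R.
Hypotheses (bf : bddm f) (f01 : forall w, 0 <= f w <= 1).

Let mU : measurable_fun setT U. Proof. exact: measurable_funP. Qed.

(** A weight at most 1 gives ]x, y] no more mass than the uniform law does. This makes [ginvK]
    applicable to Psi1 and Psi2. *)
Lemma weighted_cdf_lipschitz (x y : R) : x <= y ->
  weighted_cdf Pr f U y <= weighted_cdf Pr f U x + (y - x).
Proof.
move=> xy; have bU t := bddm_bool R (measurable_le_cst t mU).
have bfU t := bddmM bf (bU t).
have : weighted_cdf Pr f U y <=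
    weighted_cdf Pr f U x + (\int[Pr]_w (U w <= y)%R%:R - \int[Pr]_w (U w <= x)%R%:R).
  rewrite /weighted_cdf -expectation_sub// -expectation_add//; last exact: bddmB.
  apply: expectation_le_bddm => //; first by apply: bddmD => //; exact: bddmB.
  move=> w; have /andP[f0 f1] := f01 w.
  have [Ux|Ux] := leP (U w) x.
    by rewrite (le_trans Ux xy); lra.
  by case: (U w <= y); rewrite -?[true%:R]/(1 : R) -?[false%:R]/(0 : R); lra.
by rewrite !uniform01_cdf; have := clip01_lipschitz xy; lra.
Qed.

Lemma weighted_cdf0 : weighted_cdf Pr f U 0 = 0.
Proof.
have bU t := bddm_bool R (measurable_le_cst t mU).
apply/le_anti/andP; split; last by apply: weighted_cdf_ge0 => w; case/andP: (f01 w).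
apply: (@le_trans _ _ (\int[Pr]_w (U w <= 0)%R%:R)).
  apply: expectation_le_bddm => //; first exact: bddmM.
  by move=> w; have /andP[f0 f1] := f01 w; case: (U w <= 0); rewrite -?[true%:R]/(1 : R) -?[false%:R]/(0 : R); lra.
by rewrite uniform01_cdf clip01_id// lexx ler01.
Qed.

End uniform_lipschitz.

(** * The reversible kernel and its label *)

Section martingale_coupling.
Context d (T : measurableType d) (R : realType) (Pr : probability T R).
Variables U W : {RV Pr >-> R}.
Hypotheses (U_unif : uniform01 U) (U01 : forall w, 0 <= U w <= 1).
Hypotheses (W_unif : uniform01 W) (UW : independent U W).
(** Mean displacements, upward and downward, of the kernel to be built. They stand for (q(u) - u)^+,
    possibly cut off, and (u - q(u))^+. *)
Variables w1 w2 : R -> R.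
Hypotheses (mw1 : measurable_fun setT w1) (mw2 : measurable_fun setT w2).
Hypotheses (w1_ge0 : forall u, 0 <= w1 u) (w2_ge0 : forall u, 0 <= w2 u).
Hypotheses (w1_le1 : forall u : R, 0 <= u <= 1 -> w1 u <= 1).
Hypotheses (w2_le1 : forall u : R, 0 <= u <= 1 -> w2 u <= 1).
Hypothesis w12_disj : forall u, 0 < w1 u -> w2 u = 0.
(* Ensures that [w1 u / (v - u)] and [w2 v / (v - u)] are probabilities. *)
Hypothesis w12_gap : forall u v : R, u < v -> 0 < w1 u -> 0 < w2 v ->
  w1 u <= v - u /\ w2 v <= v - u.

Let mU : measurable_fun setT U. Proof. exact: measurable_funP. Qed.
Let bU : bddm U. Proof. exact: bddm_itv U01. Qed.
Let f1 w := w1 (U w).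
Let f2 w := w2 (U w).
Let f1_01 w : 0 <= f1 w <= 1. Proof. by rewrite w1_ge0 w1_le1. Qed.
Let f2_01 w : 0 <= f2 w <= 1. Proof. by rewrite w2_ge0 w2_le1. Qed.
Let f1_0 w : 0 <= f1 w. Proof. exact: w1_ge0. Qed.
Let f2_0 w : 0 <= f2 w. Proof. exact: w2_ge0. Qed.
Let bf1 : bddm f1. Proof. by apply: bddm_itv f1_01; exact: measurableT_comp. Qed.
Let bf2 : bddm f2. Proof. by apply: bddm_itv f2_01; exact: measurableT_comp. Qed.

Local Notation G1 := (weighted_cdf Pr f1 U).
Local Notation G2 := (weighted_cdf Pr f2 U).
(** The inequality puts upper partners to the right of lower ones; equal total masses leave no
    weight unpaired. *)
Hypothesis G21 : forall t : R, 0 <= t <= 1 -> G2 t <= G1 t.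
Hypothesis G12_1 : G1 1 = G2 1.

Let G1_nd : increasing G1. Proof. exact: weighted_cdf_increasing. Qed.
Let G2_nd : increasing G2. Proof. exact: weighted_cdf_increasing. Qed.
(** The pairs are (a(z), b(z)) for a level of mass z in [0, M]. [s1] and [s2] lead from a point to
    its upper and lower partner, and [Z] is uniform on [0, M]. *)
Let M := G1 1.
Let a := ginv G1 0 1.
Let b := ginv G2 0 1.
Let s1 u := b (G1 u).
Let s2 u := a (G2 u).
Let Z w := M * clip01 (U w).

Let Z_itv w : 0 <= Z w <= M.
Proof.
have M0 : 0 <= M by exact: weighted_cdf_ge0.
by case/andP: (clip01_itv (U w)) => u0 u1; rewrite mulr_ge0//= ler_piMr.
Qed.

Let aK w : G1 (a (Z w)) = Z w.
Proof.
apply: ginvK => //; [exact: weighted_cdf_right_semicontinuous| |].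
  by rewrite weighted_cdf0.
by move=> x y; exact: weighted_cdf_lipschitz.
Qed.

Let bK w : G2 (b (Z w)) = Z w.
Proof.
apply: ginvK => //; [exact: weighted_cdf_right_semicontinuous| |].
  by rewrite weighted_cdf0// -G12_1.
by move=> x y; exact: weighted_cdf_lipschitz.
Qed.

Let a_le_b w : a (Z w) <= b (Z w).
Proof.
have b01 := ginv_itv G2 (@ler01 R) (Z w).
rewrite /a ginv_le//; last by case/andP: (Z_itv w).
- by rewrite -[leLHS]bK; exact: G21.
- exact: weighted_cdf_right_semicontinuous.
Qed.

Let ms1 : measurable_fun setT s1.
Proof.
by apply: increasing_measurable => x y xy; apply: ginv_increasing => //; exact: G1_nd.
Qed.

Let ms2 : measurable_fun setT s2.
Proof.
by apply: increasing_measurable => x y xy; apply: ginv_increasing => //; exact: G2_nd.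
Qed.

(** Under the weight [w1], [U] is distributed as a(Z), and [aK] turns its partner into b(Z). With
    [law2], the pairs (U, s1 U) weighted by [w1] and (s2 U, U) weighted by [w2] have one law; this
    replaces s2 (s1 u) = u, which can fail where [G1] is flat. *)
Let law1 (h : R -> R -> R) : measurable_fun setT (fun u => h u (s1 u)) ->
    (forall u v : R, 0 <= h u v) ->
  \int[Pr]_w (f1 w * h (U w) (s1 (U w))) = \int[Pr]_w (M * h (a (Z w)) (b (Z w))).
Proof.
move=> mh h0; rewrite /Rintegral; congr fine.
have mhe : measurable_fun setT (fun u => (h u (s1 u))%:E : \bar R) by exact/measurable_EFinP.
have q := quantile_law U_unif bf1 f1_0 mU U01 mhe (fun u => h0 _ _).
apply: etrans (etrans _ q) _; first by apply: eq_integral => w _; rewrite EFinM.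
apply: eq_integral => w _.
by rewrite -EFinM -/M -/(Z w) -/(a (Z w)) /s1 aK.
Qed.

Let law2 (h : R -> R -> R) : measurable_fun setT (fun u => h (s2 u) u) ->
    (forall u v : R, 0 <= h u v) ->
  \int[Pr]_w (f2 w * h (s2 (U w)) (U w)) = \int[Pr]_w (M * h (a (Z w)) (b (Z w))).
Proof.
move=> mh h0; rewrite /Rintegral; congr fine.
have mhe : measurable_fun setT (fun u => (h (s2 u) u)%:E : \bar R) by exact/measurable_EFinP.
have q := quantile_law U_unif bf2 f2_0 mU U01 mhe (fun u => h0 _ _).
apply: etrans (etrans _ q) _; first by apply: eq_integral => w _; rewrite EFinM.
apply: eq_integral => w _.
by rewrite -EFinM -G12_1 -/M -/(Z w) -/(b (Z w)) /s2 bK.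
Qed.

Let ae_bool (f : T -> R) (c : T -> bool) : bddm f -> (forall w, 0 <= f w) ->
    measurable_fun setT c -> \int[Pr]_w (f w * (c w)%:R) = 0 ->
  {ae Pr, forall w, 0 < f w -> ~~ c w}.
Proof.
move=> bf f0 mc e; have bc := bddm_bool R mc.
have := expectation_eq0_ae (bddmM bf bc) _ e.
move=> /(_ (fun w => mulr_ge0 (f0 w) (ler0n _ _))).
apply: filterS => w /eqP; rewrite mulf_eq0 pnatr_eq0 eqb0 => /orP[/eqP->|//].
by rewrite ltxx.
Qed.

Let ms1U : measurable_fun setT (fun w => s1 (U w)). Proof. exact: measurableT_comp ms1 mU. Qed.
Let ms2U : measurable_fun setT (fun w => s2 (U w)). Proof. exact: measurableT_comp ms2 mU. Qed.

Let expectation0 (f : T -> R) : (forall w, f w = 0) -> \int[Pr]_w f w = 0.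
Proof.
by move=> f0; rewrite -[RHS](expectation_const Pr 0); apply: eq_Rintegral => w _; rewrite f0.
Qed.

(** The partner is not to the left since a <= b. The weight [w2] is positive there, because by
    [law1] and [law2] the event that it vanishes has the mass that [w2] gives to its own zeros.
    Disjointness then makes the inequality strict. *)
Let s1_ae : {ae Pr, forall w, 0 < f1 w -> U w < s1 (U w) /\ f1 w <= s1 (U w) - U w}.
Proof.
have mc : measurable_fun setT (fun u : R => s1 u < u) by exact: measurable_fun_ltr.
have mc' : measurable_fun setT (fun u => w2 (s1 u) <= 0).
  by apply: measurable_le_cst; exact: measurableT_comp.
have A1 : {ae Pr, forall w, 0 < f1 w -> ~~ (s1 (U w) < U w)}.
  apply: ae_bool => //; first exact: (measurableT_comp mc mU).
  rewrite (law1 (h := fun u v : R => (v < u)%R%:R))//.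
    by apply: expectation0 => w; rewrite ltNge a_le_b mulr0.
  exact: bddm_measurable (bddm_bool R mc).
have A2 : {ae Pr, forall w, 0 < f1 w -> ~~ (w2 (s1 (U w)) <= 0)}.
  apply: ae_bool => //; first exact: (measurableT_comp mc' mU).
  rewrite (law1 (h := fun u v => (w2 v <= 0)%R%:R))//; last first.
    exact: bddm_measurable (bddm_bool R mc').
  rewrite -(law2 (h := fun u v => (w2 v <= 0)%R%:R))//.
    apply: expectation0 => w; case: leP => [w20|_]; last by rewrite mulr0.
    by rewrite mulr1; apply/le_anti; rewrite w20 f2_0.
  by apply: bddm_measurable; apply: bddm_bool; exact: measurable_le_cst.
apply: filterS2 A1 A2 => w A1 A2 f1w.
have {A1} := A1 f1w; rewrite -leNgt => A1; have {A2} := A2 f1w; rewrite -ltNge => A2.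
suff us : U w < s1 (U w) by split=> //; exact: (w12_gap us f1w A2).1.
rewrite lt_neqAle A1 andbT; apply/eqP => e.
by move: A2; rewrite -e (w12_disj f1w) ltxx.
Qed.

Let s2_ae : {ae Pr, forall w, 0 < f2 w -> s2 (U w) < U w /\ f2 w <= U w - s2 (U w)}.
Proof.
have mc : measurable_fun setT (fun u : R => u < s2 u) by exact: measurable_fun_ltr.
have mc' : measurable_fun setT (fun u => w1 (s2 u) <= 0).
  by apply: measurable_le_cst; exact: measurableT_comp.
have A1 : {ae Pr, forall w, 0 < f2 w -> ~~ (U w < s2 (U w))}.
  apply: ae_bool => //; first exact: (measurableT_comp mc mU).
  rewrite (law2 (h := fun u v : R => (v < u)%R%:R))//.
    by apply: expectation0 => w; rewrite ltNge a_le_b mulr0.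
  exact: bddm_measurable (bddm_bool R mc).
have A2 : {ae Pr, forall w, 0 < f2 w -> ~~ (w1 (s2 (U w)) <= 0)}.
  apply: ae_bool => //; first exact: (measurableT_comp mc' mU).
  rewrite (law2 (h := fun u v => (w1 u <= 0)%R%:R))//; last first.
    exact: bddm_measurable (bddm_bool R mc').
  rewrite -(law1 (h := fun u v => (w1 u <= 0)%R%:R))//.
    apply: expectation0 => w; case: leP => [w10|_]; last by rewrite mulr0.
    by rewrite mulr1; apply/le_anti; rewrite w10 f1_0.
  by apply: bddm_measurable; apply: bddm_bool; exact: measurable_le_cst.
apply: filterS2 A1 A2 => w A1 A2 f2w.
have {A1} := A1 f2w; rewrite -leNgt => A1; have {A2} := A2 f2w; rewrite -ltNge => A2.
suff us : s2 (U w) < U w by split=> //; exact: (w12_gap us A2 f2w).2.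
rewrite lt_neqAle A1 andbT; apply/eqP => e.
by move: (w12_disj A2); rewrite e => w20; move: f2w; rewrite /f2 w20 ltxx.
Qed.

(* The power (_)^(-1) is used instead of the inverse because it is nonnegative
   everywhere and known to be measurable. *)
Let k1 u := clip01 (w1 u * (s1 u - u) `^ (-1)).
Let k2 u := clip01 (w2 u * (u - s2 u) `^ (-1)).

Let mpow (g : R -> R) : measurable_fun setT g -> measurable_fun setT (fun u : R => g u `^ (-1)).
Proof. by move=> mg; exact: (measurableT_comp (measurable_powR (-1)) mg). Qed.

Let mid_ : measurable_fun setT (@id R). Proof. exact: measurable_id. Qed.

Let mk1 : measurable_fun setT k1.
Proof.
apply: bddm_measurable; apply: bddm_clip01; apply: measurable_funM => //.
by apply: mpow; exact: measurable_funB.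
Qed.

Let mk2 : measurable_fun setT k2.
Proof.
apply: bddm_measurable; apply: bddm_clip01; apply: measurable_funM => //.
by apply: mpow; exact: measurable_funB.
Qed.

Let clip01_0 : clip01 (0 : R) = 0. Proof. by rewrite clip01_id// lexx ler01. Qed.

Let k_id (x y : R) : 0 < x -> 0 <= y <= x -> clip01 (y * x `^ (-1)) = y * x `^ (-1).
Proof.
move=> x0 /andP[y0 yx]; rewrite (powR_inv1 (ltW x0)) clip01_id//.
by rewrite (divr_ge0 y0 (ltW x0))/= ler_pdivrMr// mul1r.
Qed.

(** Almost everywhere the clipping in [k1] is inactive, and probability times jump is the prescribed
    mean displacement. *)
Let k1_ae : {ae Pr, forall w, k1 (U w) = f1 w * (s1 (U w) - U w) `^ (-1) /\
  k1 (U w) * (s1 (U w) - U w) = f1 w}.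
Proof.
apply: filterS s1_ae => w; have := f1_0 w; rewrite le_eqVlt => /predU1P[f1w _|f1w /(_ f1w)[us fs]].
  by rewrite /k1 -/(f1 w) -f1w !mul0r clip01_0 mul0r.
have u0 : 0 < s1 (U w) - U w by rewrite subr_gt0.
rewrite /k1 k_id ?f1_0//; split=> //.
by rewrite (powR_inv1 (ltW u0)) divfK// gt_eqF.
Qed.

Let k2_ae : {ae Pr, forall w, k2 (U w) = f2 w * (U w - s2 (U w)) `^ (-1) /\
  k2 (U w) * (U w - s2 (U w)) = f2 w}.
Proof.
apply: filterS s2_ae => w; have := f2_0 w; rewrite le_eqVlt => /predU1P[f2w _|f2w /(_ f2w)[us fs]].
  by rewrite /k2 -/(f2 w) -f2w !mul0r clip01_0 mul0r.
have u0 : 0 < U w - s2 (U w) by rewrite subr_gt0.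
rewrite /k2 k_id ?f2_0//; split=> //.
by rewrite (powR_inv1 (ltW u0)) divfK// gt_eqF.
Qed.

(* Detailed balance for the kernel moving u to s1 u with probability k1 u and to
   s2 u with probability k2 u. *)
Let reversible (h : R -> R -> R) :
    measurable_fun setT (fun u => h u (s1 u)) -> measurable_fun setT (fun u => h (s2 u) u) ->
    (forall u v : R, 0 <= h u v) ->
  \int[Pr]_w (k1 (U w) * h (U w) (s1 (U w))) = \int[Pr]_w (k2 (U w) * h (s2 (U w)) (U w)).
Proof.
move=> mh1 mh2 h0.
(* Both directions carry the same factor, the inverse of the gap; once absorbed in [H], only [law1]
   and [law2] are left. *)
pose H u v := (v - u) `^ (-1) * h u v.
have mH1 : measurable_fun setT (fun u => H u (s1 u)).
  apply: measurable_funM => //.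
  by apply: mpow; exact: measurable_funB.
have mH2 : measurable_fun setT (fun u => H (s2 u) u).
  apply: measurable_funM => //.
  by apply: mpow; exact: measurable_funB.
have H0 u v : 0 <= H u v by rewrite mulr_ge0// powR_ge0.
have E (p q : T -> R) : measurable_fun setT p -> measurable_fun setT q ->
    {ae Pr, forall w, p w = q w} -> \int[Pr]_w p w = \int[Pr]_w q w.
  move=> mp mq pq; rewrite /Rintegral; congr fine; apply: ae_eq_integral => //.
  - exact/measurable_EFinP.
  - exact/measurable_EFinP.
  - by apply: filterS pq => w ->.
transitivity (\int[Pr]_w (f1 w * H (U w) (s1 (U w)))).
  apply: E.
  - apply: measurable_funM; [exact: measurableT_comp mk1 mU|exact: (measurableT_comp mh1 mU)].
  - apply: measurable_funM; [exact: bddm_measurable|exact: (measurableT_comp mH1 mU)].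
  - by apply: filterS k1_ae => w [-> _]; rewrite mulrA.
rewrite law1// -law2//.
apply: E.
- apply: measurable_funM; [exact: bddm_measurable|exact: (measurableT_comp mH2 mU)].
- apply: measurable_funM; [exact: measurableT_comp mk2 mU|exact: (measurableT_comp mh2 mU)].
- by apply: filterS k2_ae => w [-> _]; rewrite mulrA.
Qed.

(** One threshold serves both moves, as [k1] and [k2] are never positive at the same point. *)
Let L w := if W w < k1 (U w) then s1 (U w) else if W w < k2 (U w) then s2 (U w) else U w.

Let mL : measurable_fun setT L.
Proof.
have mW : measurable_fun setT W by exact: measurable_funP.
have mk1U := measurable_fun_ltr mW (measurableT_comp mk1 mU).
have mk2U := measurable_fun_ltr mW (measurableT_comp mk2 mU).
exact: (measurable_fun_ifT mk1U ms1U (measurable_fun_ifT mk2U ms2U mU)).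
Qed.

Let L01 w : 0 <= L w <= 1.
Proof. by rewrite /L; case: ifP => _; [|case: ifP => _]; [exact: ginv_itv|exact: ginv_itv|exact: U01]. Qed.

Let k1_01 u : 0 <= k1 u <= 1. Proof. exact: clip01_itv. Qed.
Let k2_01 u : 0 <= k2 u <= 1. Proof. exact: clip01_itv. Qed.
Let bk1 : bddm (fun w => k1 (U w)).
Proof. by apply: bddm_itv (fun w => k1_01 (U w)); exact: (measurableT_comp mk1 mU). Qed.
Let bk2 : bddm (fun w => k2 (U w)).
Proof. by apply: bddm_itv (fun w => k2_01 (U w)); exact: (measurableT_comp mk2 mU). Qed.

Let balance (l p q u r s : R) :
  l + (p + q) = u + (r + s) -> l = u + (s - p) + (r - q).
Proof. by lra. Qed.

(** Given L, [U] is distributed by the kernel started at L. Taking [c] constant 1 gives the law of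
    [L]; taking [clip01], which is the identity on [0, 1], gives the expectation of [U] on the rays
    of [L]. *)
Let L_expectation (c : R -> R) (t : R) : measurable_fun setT c ->
    (forall u, 0 <= c u <= 1) ->
  \int[Pr]_w (c (U w) * (L w <= t)%R%:R) =
  \int[Pr]_w (c (U w) * (U w <= t)%R%:R) +
  \int[Pr]_w (k1 (U w) * (c (s1 (U w)) - c (U w)) * (U w <= t)%R%:R) +
  \int[Pr]_w (k2 (U w) * (c (s2 (U w)) - c (U w)) * (U w <= t)%R%:R).
Proof.
move=> mc c01; have c0 u : 0 <= c u by case/andP: (c01 u).
have bc (X : T -> R) : measurable_fun setT X -> bddm (fun w : T => c (X w)).
  by move=> mX; apply: bddm_itv (fun w => c01 (X w)); exact: (measurableT_comp mc mX).
have bt (X : T -> R) : measurable_fun setT X -> bddm (fun w : T => (X w <= t)%R%:R : R).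
  by move=> mX; exact: (bddm_bool R (measurable_le_cst t mX)).
have mW : measurable_fun setT W by exact: measurable_funP.
have bW (k : R -> R) : measurable_fun setT k -> bddm (fun w => (W w < k (U w))%R%:R : R).
  by move=> mk; exact: (bddm_bool R (measurable_fun_ltr mW (measurableT_comp mk mU))).
have bcU := bc U mU; have bcs1 := bc _ ms1U; have bcs2 := bc _ ms2U.
have btU := bt U mU; have bts1 := bt _ ms1U; have bts2 := bt _ ms2U; have btL := bt _ mL.
have bW1 := bW _ mk1; have bW2 := bW _ mk2.
have mt (X : R -> R) : measurable_fun setT X -> measurable_fun setT (fun u : R => (X u <= t)%R%:R : R).
  by move=> mX; exact: (bddm_measurable (bddm_bool R (measurable_le_cst t mX))).
have TH (g k : R -> R) : measurable_fun setT g -> measurable_fun setT k ->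
    (forall x, 0 <= g x) -> (forall x, 0 <= k x <= 1) ->
    \int[Pr]_w (g (U w) * (W w < k (U w))%R%:R) = \int[Pr]_w (k (U w) * g (U w)).
  move=> mg mk g0 k01; rewrite (expectation_threshold W_unif UW)//.
  by apply: eq_Rintegral => w _; rewrite mulrC.
have th1 := TH (fun u => c u * (u <= t)%R%:R) k1 (measurable_funM mc (mt _ mid_)) mk1
  (fun u => mulr_ge0 (c0 u) (ler0n _ _)) k1_01.
have th2 := TH (fun u => c u * (u <= t)%R%:R) k2 (measurable_funM mc (mt _ mid_)) mk2
  (fun u => mulr_ge0 (c0 u) (ler0n _ _)) k2_01.
have th3 := TH (fun u => c u * (s1 u <= t)%R%:R) k1 (measurable_funM mc (mt _ ms1)) mk1
  (fun u => mulr_ge0 (c0 u) (ler0n _ _)) k1_01.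
have th4 := TH (fun u => c u * (s2 u <= t)%R%:R) k2 (measurable_funM mc (mt _ ms2)) mk2
  (fun u => mulr_ge0 (c0 u) (ler0n _ _)) k2_01.
(* Upward arrivals in L <= t become downward departures from U <= t; [r2] does the same for downward
   arrivals. *)
have r1 := @reversible (fun u v => c u * (v <= t)%R%:R) (measurable_funM mc (mt _ ms1))
  (measurable_funM (measurableT_comp mc ms2) (mt _ mid_)) (fun u v => mulr_ge0 (c0 u) (ler0n _ _)).
have r2 := @reversible (fun u v => c v * (u <= t)%R%:R)
  (measurable_funM (measurableT_comp mc ms1) (mt _ mid_))
  (measurable_funM mc (mt _ ms2)) (fun u v => mulr_ge0 (c0 v) (ler0n _ _)).
rewrite /= in th1 th2 th3 th4 r1 r2.
(* Pointwise account of the three cases of [L], with departures added on the left. As W >= 0 almost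
   surely, a vanishing [k2] excludes the second test whenever the first one succeeds. *)
have key : \int[Pr]_w (c (U w) * (L w <= t)%R%:R +
      (c (U w) * (U w <= t)%R%:R * (W w < k1 (U w))%R%:R +
       c (U w) * (U w <= t)%R%:R * (W w < k2 (U w))%R%:R)) =
    \int[Pr]_w (c (U w) * (U w <= t)%R%:R +
      (c (U w) * (s1 (U w) <= t)%R%:R * (W w < k1 (U w))%R%:R +
       c (U w) * (s2 (U w) <= t)%R%:R * (W w < k2 (U w))%R%:R)).
  apply: expectation_ae_eq.
  - by apply: bddmD; [exact: bddmM|apply: bddmD; apply: bddmM => //; exact: bddmM].
  - by apply: bddmD; [exact: bddmM|apply: bddmD; apply: bddmM => //; exact: bddmM].
  apply: filterS (uniform01_ae W_unif) => w /andP[Ww _].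
  rewrite /L; case: ifPn => Wk1; last first.
    by case: ifPn => Wk2; rewrite ?mulr0 ?mulr1 ?add0r ?addr0//; ring.
  have w1U : 0 < w1 (U w).
    rewrite lt_neqAle w1_ge0 andbT eq_sym; apply/eqP => w10.
    by have := le_lt_trans Ww Wk1; rewrite /k1 w10 mul0r clip01_0 ltxx.
  have -> : k2 (U w) = 0 by rewrite /k2 (w12_disj w1U) mul0r clip01_0.
  by rewrite ltNge Ww/= ?mulr0 ?mulr1 ?add0r ?addr0; ring.
move: key.
have bcUt := bddmM bcU btU.
have [bcUt1 bcUt2] := (bddmM bcUt bW1, bddmM bcUt bW2).
have [bcs1t bcs2t] := (bddmM (bddmM bcU bts1) bW1, bddmM (bddmM bcU bts2) bW2).
rewrite (expectation_add Pr (bddmM bcU btL) (bddmD bcUt1 bcUt2)) (expectation_add Pr bcUt1 bcUt2).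
rewrite (expectation_add Pr bcUt (bddmD bcs1t bcs2t)) (expectation_add Pr bcs1t bcs2t).
rewrite th1 th2 th3 th4 r1 -r2 => key.
have d1 : \int[Pr]_w (k1 (U w) * (c (s1 (U w)) - c (U w)) * (U w <= t)%R%:R) =
    \int[Pr]_w (k1 (U w) * (c (s1 (U w)) * (U w <= t)%R%:R)) -
    \int[Pr]_w (k1 (U w) * (c (U w) * (U w <= t)%R%:R)).
  rewrite -expectation_sub; try by apply: bddmM => //; exact: bddmM.
  by apply: eq_Rintegral => w _; ring.
have d2 : \int[Pr]_w (k2 (U w) * (c (s2 (U w)) - c (U w)) * (U w <= t)%R%:R) =
    \int[Pr]_w (k2 (U w) * (c (s2 (U w)) * (U w <= t)%R%:R)) -
    \int[Pr]_w (k2 (U w) * (c (U w) * (U w <= t)%R%:R)).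
  rewrite -expectation_sub; try by apply: bddmM => //; exact: bddmM.
  by apply: eq_Rintegral => w _; ring.
rewrite d1 d2; exact: balance key.
Qed.

Lemma martingale_coupling : exists L : {RV Pr >-> R},
  [/\ forall w, 0 <= L w <= 1, eq_law Pr L U &
      forall t : R, \int[Pr]_w (U w * (L w <= t)%R%:R) =
        \int[Pr]_w ((U w + w1 (U w) - w2 (U w)) * (U w <= t)%R%:R)].
Proof.
have [L' L'E] := exists_RV Pr mL; exists L'; rewrite L'E; split; first exact: L01.
- apply: eq_law_cdf => // t.
  have c1 (u : R) : 0 <= (cst 1 : R -> R) u <= 1 by rewrite /= ler01 lexx.
  have := L_expectation t (measurable_cst (1 : R)) c1; rewrite /=.
  have E1 (X : T -> R) : \int[Pr]_w (1 * (X w <= t)%R%:R) = \int[Pr]_w (X w <= t)%R%:R.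
    by apply: eq_Rintegral => w _; rewrite mul1r.
  have K (k : R -> R) : \int[Pr]_w (k (U w) * (1 - 1) * (U w <= t)%R%:R) = 0.
    by apply: expectation0 => w; rewrite subrr mulr0 mul0r.
  by rewrite !E1 => ->; rewrite (K k1) (K k2) !addr0.
move=> t.
have UE w : clip01 (U w) = U w by rewrite clip01_id.
have := L_expectation t (@measurable_clip01 R) (@clip01_itv R).
have E1 (X : T -> R) : \int[Pr]_w (clip01 (U w) * (X w <= t)%R%:R) = \int[Pr]_w (U w * (X w <= t)%R%:R).
  by apply: eq_Rintegral => w _; rewrite UE.
have btU := bddm_bool R (measurable_le_cst t mU).
rewrite !E1 => ->.
have -> : \int[Pr]_w (k1 (U w) * (clip01 (s1 (U w)) - clip01 (U w)) * (U w <= t)%R%:R) =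
    \int[Pr]_w (f1 w * (U w <= t)%R%:R).
  apply: expectation_ae_eq.
  - by apply: bddmM => //; apply: bddmM => //; apply: bddmB; exact: bddm_clip01.
  - exact: bddmM.
  - apply: filterS k1_ae => w [_ <-]; rewrite UE (clip01_id (x := s1 (U w)))//.
    exact: ginv_itv.
have -> : \int[Pr]_w (k2 (U w) * (clip01 (s2 (U w)) - clip01 (U w)) * (U w <= t)%R%:R) =
    \int[Pr]_w ((- 1) * (f2 w * (U w <= t)%R%:R)).
  apply: expectation_ae_eq.
  - by apply: bddmM => //; apply: bddmM => //; apply: bddmB; exact: bddm_clip01.
  - by apply: bddmM; [exact: bddm_cst|exact: bddmM].
  - apply: filterS k2_ae => w [_ <-]; rewrite UE (clip01_id (x := s2 (U w))); first by ring.
    exact: ginv_itv.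
have bUt := bddmM bU btU; have b1t := bddmM bf1 btU; have b2t := bddmM bf2 btU.
rewrite -!expectation_add//.
- by apply: eq_Rintegral => w _; rewrite /f1 /f2; ring.
- exact: bddmD.
- by apply: bddmM => //; exact: bddm_cst.
Qed.

End martingale_coupling.
(** * p*-variables *)

Section pstar_variables.
Context d (T : measurableType d) (R : realType) (Pr : probability T R).

Lemma eq_law_preimage (X Y : T -> R) (A : set R) : measurable_fun setT X ->
  measurable_fun setT Y -> eq_law Pr X Y -> measurable A ->
  Pr (X @^-1` A) = Pr (Y @^-1` A).
Proof.
move=> mX mY XY mA.
have ind (Z : T -> R) : measurable_fun setT Z ->
    Pr (Z @^-1` A) = (\int[Pr]_w (\1_A (Z w))%:E)%E.
  move=> mZ; have mZA : measurable (Z @^-1` A) by rewrite -[X in measurable X]setTI; exact: mZ.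
  by have := @integral_indic _ _ _ Pr setT measurableT _ mZA; rewrite setIT => <-.
rewrite (ind X mX) (ind Y mY); apply: (XY (fun y => (\1_A y)%:E)).
  by apply/measurable_EFinP; exact: measurable_indic.
by move=> y; rewrite lee_fin.
Qed.

Lemma uniform01_clip (U V : {RV Pr >-> R}) : uniform01 U ->
  V = (fun w => clip01 (U w)) :> (T -> R) -> uniform01 V.
Proof.
move=> U_unif VE A mA; rewrite -(U_unif A mA) /distribution /pushforward.
apply: eq_law_preimage => //; try exact: measurable_funP.
apply: eq_law_ae; try exact: measurable_funP.
by apply: filterS (uniform01_clip_ae U_unif) => w Uw; rewrite VE -Uw.
Qed.

Lemma min_increasing (c : R) : increasing (fun x => Order.min x c).
Proof. by move=> x y xy; rewrite le_min !ge_min xy lexx orbT. Qed.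

Lemma min_conv_le (s x y c : R) : 0 <= s -> s <= 1 ->
  - Order.min (s * x + (1 - s) * y) c <= s * - Order.min x c + (1 - s) * - Order.min y c.
Proof.
move=> s0 s1; rewrite !mulrN -opprD lerN2 le_min; apply/andP; split.
- by apply: lerD; apply: ler_wpM2l; rewrite ?subr_ge0// ge_min lexx.
- have {3}-> : c = s * c + (1 - s) * c by ring.
  by apply: lerD; apply: ler_wpM2l; rewrite ?subr_ge0// ge_min lexx orbT.
Qed.

Lemma min_concave (c : R) : concave (fun x => Order.min x c).
Proof.
move=> t x y _ _; rewrite convRE [X in - Order.min X c]convRE /unstable.onem.
by apply: min_conv_le.
Qed.

(** Bounded above, min(X, c) has an expectation for every [X], so these test functions apply to [P]
    whatever its tails. *)
Lemma min_expectation_exists (X : T -> R) (c : R) : measurable_fun setT X ->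
  expectation_exists Pr ((fun x => Order.min x c) \o X).
Proof.
move=> mX; left; rewrite unlock.
have bX : bddm (((fun x => Order.min x c) \o X)^\+)%R.
  apply: (@bddm_itv _ _ _ 0 (Order.max c 0)).
    apply: measurable_funrpos; apply: measurable_minr => //; exact: measurable_cst.
  move=> w; rewrite /funrpos /= le_max lexx orbT/= ge_max !le_max lexx orbT andbT.
  by rewrite ge_min lexx orbT.
by rewrite -EFin_expectation// ltry.
Qed.

(** * From the quantile function of P to the label *)

Section construction.
Variables U P : {RV Pr >-> R}.
Hypotheses (Pr_rich : rich Pr) (U_unif : uniform01 U) (P_pstar : pstar_variable P).

Let mP : measurable_fun setT P. Proof. exact: measurable_funP. Qed.
Let mU : measurable_fun setT U. Proof. exact: measurable_funP. Qed.

(** The test function min(x, 0) gives 0 <= - E[P^-]. *)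
Lemma pstar_ge0_ae : {ae Pr, forall w, 0 <= P w}.
Proof.
have [U0 [U0_unif U0P]] := P_pstar.
have mU0 : measurable_fun setT U0 by exact: measurable_funP.
have := U0P _ (min_increasing 0) (min_concave 0) (min_expectation_exists 0 mU0)
  (min_expectation_exists 0 mP).
have m0 (X : T -> R) : measurable_fun setT X -> measurable_fun setT ((fun x => Order.min x 0) \o X).
  by move=> mX; apply: measurable_minr => //; exact: measurable_cst.
have E0 : (0 <= 'E_Pr[(fun x : R => Order.min x 0%R) \o U0])%E.
  rewrite -[leLHS](expectation_cst Pr 0); apply: expectation_ae_monotone; [exact: measurable_cst|exact: m0|].
  by apply: filterS (uniform01_ae U0_unif) => w /andP[U00 _]; rewrite /= min_r.
move=> /(le_trans E0) {E0}.
pose g w := Order.max (- P w) 0.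
have mg : measurable_fun setT (EFin \o g).
  by apply/measurable_EFinP; apply: measurable_maxr; [exact: measurable_funN|exact: measurable_cst].
have g0 w : 0 <= g w by rewrite /g le_max lexx orbT.
have -> : ('E_Pr[(fun x : R => Order.min x 0%R) \o P] = - \int[Pr]_w (g w)%:E)%E.
  rewrite unlock -integral_ge0N//; last by move=> w _; rewrite lee_fin.
  apply: eq_integral => w _; rewrite -EFinN /g /=; congr EFin.
  by rewrite oppr_max opprK oppr0.
rewrite oppe_ge0 => gle.
have : (\int[Pr]_w `|(EFin \o g) w| = 0)%E.
  transitivity (\int[Pr]_w (g w)%:E)%E.
    by apply: eq_integral => w _; rewrite gee0_abs// lee_fin.
  by apply/le_anti; rewrite gle/=; apply: integral_ge0 => w _; rewrite lee_fin.
move=> /(ae_eq_integral_abs Pr measurableT mg); apply: filterS => w /(_ I) [] gw.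
have : - P w <= g w by rewrite /g le_max lexx.
by rewrite gw; lra.
Qed.

Variable U1 : {RV Pr >-> R}.
Hypothesis U1E : U1 = (fun w => clip01 (U w)) :> (T -> R).

Let U1_unif : uniform01 U1. Proof. exact: uniform01_clip U1E. Qed.
Let U101 w : 0 <= U1 w <= 1. Proof. by rewrite U1E; exact: clip01_itv. Qed.
Let mU1 : measurable_fun setT U1. Proof. exact: measurable_funP. Qed.
Let bU1 : bddm U1. Proof. exact: bddm_itv U101. Qed.

Variable q : R -> R.
Hypotheses (q_nd : increasing q) (q01 : forall z, 0 <= q z <= 1).
Hypothesis q_law : eq_law Pr (fun w => clip01 (P w)) (q \o U1).

Let mq : measurable_fun setT q. Proof. exact: increasing_measurable. Qed.
Let mqU1 : measurable_fun setT (fun w => q (U1 w)). Proof. exact: (measurableT_comp mq mU1). Qed.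
Let bqU1 : bddm (fun w => q (U1 w)). Proof. exact: bddm_itv (fun w => q01 (U1 w)). Qed.
Let mclipP : measurable_fun setT (fun w => clip01 (P w)).
Proof. exact: bddm_measurable (bddm_clip01 mP). Qed.

Let bmin (X : T -> R) (c : R) : bddm X -> bddm (fun w => Order.min (X w) c).
Proof.
move=> bX; have -> : (fun w => Order.min (X w) c) = fun w => 0 - Order.max (0 - X w) (0 - c).
  by apply/funext => w; rewrite !sub0r oppr_max !opprK.
have b0 := bddm_cst T (0 : R); have bc := bddm_cst T c.
by apply: bddmB => //; apply: bddm_max; exact: bddmB.
Qed.

(** Since P >= 0 almost surely and c <= 1, truncating [P] to [0, 1] does not lower min(P, c). *)
Let expectation_min_le (c : R) : 0 <= c <= 1 ->
  \int[Pr]_w Order.min (U1 w) c <= \int[Pr]_w Order.min (q (U1 w)) c.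
Proof.
move=> /andP[c0 c1]; have [U0 [U0_unif U0P]] := P_pstar.
have mU0 : measurable_fun setT U0 by exact: measurable_funP.
have mf := increasing_measurable (min_increasing c).
have := U0P _ (min_increasing c) (min_concave c) (min_expectation_exists c mU0)
  (min_expectation_exists c mP).
rewrite (eq_law_E mU0 mU1 mf (uniform01_eq_law U1_unif U0_unif)) => h.
have {h} : ('E_Pr[(fun x : R => Order.min x c) \o U1] <= 'E_Pr[(fun x : R => Order.min x c) \o (q \o U1)])%E.
  apply: (le_trans h); rewrite -(eq_law_E mclipP mqU1 mf q_law).
  apply: expectation_ae_monotone; [exact: (measurableT_comp mf mP)|exact: (measurableT_comp mf mclipP)|].
  apply: filterS pstar_ge0_ae => w P0 /=.
  have [P1|P1] := leP (P w) 1; first by rewrite clip01_id// P0.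
  have -> : clip01 (P w) = 1 by rewrite /clip01 (min_l (ltW P1)) max_r.
  by rewrite (min_r c1) ge_min lexx orbT.
rewrite unlock -[X in (X <= _)%E]EFin_expectation; last exact: (bmin c bU1).
rewrite -[X in (_ <= X)%E]EFin_expectation; last exact: (bmin c bqU1).
by rewrite lee_fin.
Qed.

Let p1 (u : R) : R := Order.max 0 (q u - u).
Let p2 (u : R) : R := Order.max 0 (u - q u).

Let p1_ge0 u : 0 <= p1 u. Proof. by rewrite /p1 le_max lexx. Qed.
Let p2_ge0 u : 0 <= p2 u. Proof. by rewrite /p2 le_max lexx. Qed.
Let p1_le1 (u : R) : 0 <= u <= 1 -> p1 u <= 1.
Proof. by move=> /andP[u0 u1]; have /andP[q0 q1] := q01 u; rewrite /p1 ge_max ler01; lra. Qed.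
Let p2_le1 (u : R) : 0 <= u <= 1 -> p2 u <= 1.
Proof. by move=> /andP[u0 u1]; have /andP[q0 q1] := q01 u; rewrite /p2 ge_max ler01; lra. Qed.
Let mid_ : measurable_fun setT (@id R). Proof. exact: measurable_id. Qed.
Let mp1 : measurable_fun setT p1.
Proof. by apply: measurable_maxr; [exact: measurable_cst|exact: measurable_funB]. Qed.
Let mp2 : measurable_fun setT p2.
Proof. by apply: measurable_maxr; [exact: measurable_cst|exact: measurable_funB]. Qed.
Let p1U_01 w : 0 <= p1 (U1 w) <= 1. Proof. by rewrite p1_ge0 p1_le1. Qed.
Let p2U_01 w : 0 <= p2 (U1 w) <= 1. Proof. by rewrite p2_ge0 p2_le1. Qed.
Let bp1 : bddm (fun w => p1 (U1 w)).
Proof. by apply: bddm_itv p1U_01; exact: (measurableT_comp mp1 mU1). Qed.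
Let bp2 : bddm (fun w => p2 (U1 w)).
Proof. by apply: bddm_itv p2U_01; exact: (measurableT_comp mp2 mU1). Qed.

Let bt (X : T -> R) (t : R) : measurable_fun setT X -> bddm (fun w => (X w <= t)%R%:R : R).
Proof. by move=> mX; exact: (bddm_bool R (measurable_le_cst t mX)). Qed.

Let F1 := weighted_cdf Pr (fun w => p1 (U1 w)) U1.
Let F2 := weighted_cdf Pr (fun w => p2 (U1 w)) U1.

(** F1(t) - F2(t) is the expectation of (t - U) - (t - q(U)) on U <= t. There t - U integrates to t
    - E[min(U, t)], while t - q(U) integrates to at most t - E[min(q(U), t)]. *)
Let F2_le_F1 (t : R) : 0 <= t <= 1 -> F2 t <= F1 t.
Proof.
move=> t01; have bUt := bt t mU1; have ct := bddm_cst T t.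
have bmU := bmin t bU1; have bmq := bmin t bqU1.
have A1 : \int[Pr]_w ((t - q (U1 w)) * (U1 w <= t)%R%:R) <= \int[Pr]_w (t - Order.min (q (U1 w)) t).
  apply: expectation_le_bddm; [by apply: bddmM => //; exact: bddmB|exact: bddmB|].
  move=> w; have m1 : Order.min (q (U1 w)) t <= q (U1 w) by rewrite ge_min lexx.
  have m2 : Order.min (q (U1 w)) t <= t by rewrite ge_min lexx orbT.
  by case: (U1 w <= t); rewrite -?[true%:R]/(1 : R) -?[false%:R]/(0 : R); lra.
have A2 : \int[Pr]_w (t - Order.min (U1 w) t) = \int[Pr]_w ((t - U1 w) * (U1 w <= t)%R%:R).
  by apply: eq_Rintegral => w _; case: (leP (U1 w) t) => _; rewrite ?mulr1 ?mulr0 ?subrr.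
have A3 := expectation_min_le t01.
rewrite expectation_sub// expectation_const in A1.
rewrite expectation_sub// expectation_const in A2.
have A4 : F1 t - F2 t = \int[Pr]_w ((t - U1 w) * (U1 w <= t)%R%:R) -
    \int[Pr]_w ((t - q (U1 w)) * (U1 w <= t)%R%:R).
  rewrite /F1 /F2 /weighted_cdf -(expectation_sub Pr (bddmM bp1 bUt) (bddmM bp2 bUt)).
  rewrite -(expectation_sub Pr (bddmM (bddmB ct bU1) bUt) (bddmM (bddmB ct bqU1) bUt)).
  apply: eq_Rintegral => w _; rewrite -!mulrBl; congr (_ * _).
  rewrite /p1 /p2; case: (leP (q (U1 w)) (U1 w)) => qU.
    by rewrite max_l ?max_r ?subr_ge0 ?subr_le0//; ring.
  by rewrite max_r ?max_l ?subr_ge0 ?subr_le0 ?ltW//; ring.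
rewrite -subr_ge0 A4; move: A1 A2 A3.
move: (\int[Pr]_w ((t - U1 w) * _)) (\int[Pr]_w ((t - q (U1 w)) * _)) => x y.
move: (\int[Pr]_w Order.min (q (U1 w)) t) (\int[Pr]_w Order.min (U1 w) t) => x' y'.
by lra.
Qed.

(* Beyond [tau] there is no mass of [p2] left to be paired with that of [p1]. *)
Let tau := ginv F1 0 1 (F2 1).

Let tau01 : 0 <= tau <= 1. Proof. exact: ginv_itv. Qed.

Let F1_nd : increasing F1. Proof. by apply: weighted_cdf_increasing. Qed.
Let F2_nd : increasing F2. Proof. by apply: weighted_cdf_increasing. Qed.

Let F1_tau : F1 tau = F2 1.
Proof.
apply: ginvK => //.
- exact: weighted_cdf_right_semicontinuous.
- have -> : F1 0 = 0 by exact: weighted_cdf0.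
  have -> : 0 <= F2 1 by exact: weighted_cdf_ge0.
  by apply: F2_le_F1; rewrite ler01 lexx.
- by move=> x y; exact: weighted_cdf_lipschitz.
Qed.

(** The upward displacement actually used; its total mass is [F1 tau], that is, [F2 1]. *)
Let w1 (u : R) : R := p1 u * (u <= tau)%R%:R.

Let w1_ge0 u : 0 <= w1 u. Proof. by rewrite mulr_ge0. Qed.
Let w1_le_p1 u : w1 u <= p1 u. Proof. by rewrite /w1; case: (u <= tau); rewrite ?mulr1 ?mulr0. Qed.
Let mw1 : measurable_fun setT w1.
Proof.
by apply: measurable_funM => //; exact: (bddm_measurable (bddm_bool R (measurable_le_cst tau mid_))).
Qed.

Let G1E (t : R) : weighted_cdf Pr (fun w => w1 (U1 w)) U1 t = F1 (Order.min t tau).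
Proof.
apply: eq_Rintegral => w _; rewrite /w1 -mulrA le_min; congr (_ * _).
by rewrite andbC; case: (U1 w <= tau); rewrite ?mul1r ?mul0r.
Qed.

(** The conditional expectation of [U] given L = u; the maximum only forces nonnegativity outside
    [0, 1]. *)
Let y (u : R) : R := Order.max 0 (u + w1 u - p2 u).

Let yE (u : R) : 0 <= u <= 1 -> y u = u + w1 u - p2 u.
Proof.
move=> /andP[u0 _]; have /andP[q0 _] := q01 u; rewrite /y max_r//.
have := w1_ge0 u; have : p2 u <= u by rewrite /p2 ge_max u0; lra.
by lra.
Qed.

Let y_le_q (u : R) : 0 <= u <= 1 -> y u <= q u.
Proof.
move=> u01; rewrite yE//; have := w1_le_p1 u; rewrite /p1 /p2.
case: (leP (q u) u) => qu.
  rewrite (max_l (x := 0) (y := q u - u)) ?subr_le0// (max_r (x := 0)) ?subr_ge0//; lra.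
rewrite (max_r (x := 0) (y := q u - u)) ?subr_ge0 ?(ltW qu)//.
by rewrite (max_l (x := 0)) ?subr_le0 ?(ltW qu)//; lra.
Qed.

Let my : measurable_fun setT y.
Proof.
apply: measurable_maxr; first exact: measurable_cst.
by apply: measurable_funB => //; exact: measurable_funD.
Qed.

Lemma pstar_exists_cond_expectation :
  exists V : {RV Pr >-> R}, ge_st_cond_expectation P U V.
Proof.
have [W [W_unif U1W]] := exists_independent_uniform01 U1 Pr_rich.
have w1_le1 (u : R) : 0 <= u <= 1 -> w1 u <= 1.
  by move=> u01; exact: le_trans (w1_le_p1 u) (p1_le1 u01).
have p1_gt0 u : 0 < w1 u -> 0 < p1 u by move=> /lt_le_trans; apply.
have w12_disj u : 0 < w1 u -> p2 u = 0.
  by move=> /p1_gt0; rewrite /p1 /p2 lt_max ltxx/= => qu; rewrite max_l//; lra.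
have w12_gap (u v : R) : u < v -> 0 < w1 u -> 0 < p2 v -> w1 u <= v - u /\ p2 v <= v - u.
  move=> uv /p1_gt0; rewrite {1}/p1 {1}/p2 !lt_max !ltxx/= => qu qv.
  have quv := q_nd (ltW uv); have w1p := w1_le_p1 u; split.
    by apply: le_trans w1p _; rewrite /p1 ge_max; lra.
  by rewrite /p2 ge_max; lra.
have G21 (t : R) : 0 <= t <= 1 -> weighted_cdf Pr (fun w => p2 (U1 w)) U1 t <=
    weighted_cdf Pr (fun w => w1 (U1 w)) U1 t.
  (* Past [tau] the cut-off function stays at [F2 1], which bounds [F2 t]. *)
  move=> /andP[t0 t1]; rewrite G1E; have [tt|tt] := leP t tau.
    by apply: F2_le_F1; rewrite t0.
  by rewrite F1_tau; exact: F2_nd.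
have G12 : weighted_cdf Pr (fun w => w1 (U1 w)) U1 1 = weighted_cdf Pr (fun w => p2 (U1 w)) U1 1.
  by rewrite G1E min_r ?F1_tau//; case/andP: tau01.
have [L [L01 LU L_exp]] := martingale_coupling U1_unif U101 W_unif U1W mw1 mp2 w1_ge0 p2_ge0
  w1_le1 p2_le1 w12_disj w12_gap G21 G12.
have mL : measurable_fun setT L by exact: measurable_funP.
have [Y YE] := exists_RV Pr (measurableT_comp my mL).
have mY : measurable_fun setT Y by exact: measurable_funP.
have Y01 w : 0 <= Y w <= 1.
  rewrite YE /= {1}/y le_max lexx/=; apply: le_trans (y_le_q (L01 w)) _.
  by case/andP: (q01 (L w)).
exists L; exists Y; split.
  apply: (cond_expectation_rays bU1 _ _ my YE (bddm_itv mY Y01)).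
  - by move=> w; case/andP: (U101 w).
  - by rewrite U1E; exact: uniform01_clip_ae.
  - by move=> w; case/andP: (Y01 w).
  (* The coupling gives the right side as an integral of y(U1) over U1 <= t; equality in law of [L]
     and [U1] identifies it with the left side. *)
  move=> t; rewrite L_exp YE.
  have mh : measurable_fun setT (fun u : R => y u * (u <= t)%R%:R).
    apply: measurable_funM => //.
    exact: (bddm_measurable (bddm_bool R (measurable_le_cst t mid_))).
  have h0 (u : R) : 0 <= y u * (u <= t)%R%:R by rewrite mulr_ge0// /y le_max lexx.
  rewrite [LHS](eq_law_expectation LU mh h0).
  by apply: eq_Rintegral => w _; rewrite yE.
move=> f f_nd _ _; have mf := increasing_measurable f_nd.
have mqL : measurable_fun setT (q \o L) by exact: measurableT_comp.
apply: (@le_trans _ _ ('E_Pr[f \o (q \o L)])%E).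
  apply: expectation_ae_monotone; [exact: (measurableT_comp mf mY)|exact: (measurableT_comp mf mqL)|].
  by apply: aeW => w; rewrite YE /=; apply: f_nd; exact: y_le_q.
rewrite (eq_law_E mqL mqU1 mf (eq_law_comp mq LU)) -(eq_law_E mclipP mqU1 mf q_law).
apply: expectation_ae_monotone; [exact: (measurableT_comp mf mclipP)|exact: (measurableT_comp mf mP)|].
apply: filterS pstar_ge0_ae => w P0; apply: f_nd.
by rewrite /clip01 ge_max P0/= ge_min lexx orbT.
Qed.

End construction.

Lemma pstar_variable_cond_expectation (U P : {RV Pr >-> R}) : rich Pr -> uniform01 U ->
  pstar_variable P <-> exists V : {RV Pr >-> R}, ge_st_cond_expectation P U V.
Proof.
move=> Pr_rich U_unif; split=> [P_pstar|[V [Y [hY YP]]]]; last first.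
  exact: cond_expectation_pstar U_unif hY YP.
have mU : measurable_fun setT U by exact: measurable_funP.
have mP : measurable_fun setT P by exact: measurable_funP.
have [U1 U1E] := exists_RV Pr (bddm_measurable (bddm_clip01 mU)).
have U1_unif := uniform01_clip U_unif U1E.
have [q [q_nd q01 q_law]] := exists_quantile U1_unif (bddm_measurable (bddm_clip01 mP))
  ler01 (fun w => clip01_itv (P w)).
exact: pstar_exists_cond_expectation Pr_rich U_unif P_pstar _ U1E q q_nd q01 q_law.
Qed.

End pstar_variables.
Theorem theorem3p1 (d : measure_display) (T : measurableType d) (R : realType)
    (Pr : probability T R) (Pr_atomless : atomless Pr) (Pr_rich : rich Pr)
    (U : {RV Pr >-> R}) (U_unif : uniform01 U) (P : {RV Pr >-> R}) :
  (p_variable P <->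
    exists V : {RV Pr >-> R},
      (exists g : R -> R, strictly_increasing g /\ V = g \o U :> (T -> R)) /\
      ge_st_cond_expectation P U V) /\
  (mid_p_variable P <->
    exists V : {RV Pr >-> R},
      (exists g : R -> R, increasing g /\ V = g \o U :> (T -> R)) /\
      ge_st_cond_expectation P U V) /\
  (pstar_variable P <->
    exists V : {RV Pr >-> R}, ge_st_cond_expectation P U V).
Proof.
split; first exact: p_variable_cond_expectation.
split; first exact: mid_p_variable_cond_expectation.
exact: pstar_variable_cond_expectation.
Qed.
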